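(* Let $\nu$ be a probability measure on $(\mathcal{X},\mathcal{B})$, $\mathcal{X}_0\subset\mathcal{X}$ a Borel set and $T:\mathcal{X}_0\to\mathcal{X}$ a mapping such that 1) $\nu(\mathcal{X}_0)=1$; 2) $T$ is measurable and injective; 3) $\nu\circ T^{-1}=\mu$; 4) for each $x\in\mathcal{X}_0$, $T(x)-x\in\mathcal{H}$; 5) $\nu\ll\mu$. Let $I^\nu_nA_n=(I^\mu_nA_n)\circ T$ for $A_n\in\mathcal{L}^{(n)}_{HS}(\mathcal{H})$. Then for all $n\ge0$ and $A_n\in\mathcal{L}^{(n)}_{HS}(\mathcal{H})$, $$I^\nu_nA_n(x)=\sum_{m=0}^n\binom{n}{m}\,I^\mu_{n-m}A_n(x)\big(T(x)-x,\ldots,T(x)-x\big)\quad\text{for }\nu\text{-a.e. }x,$$ where in the $m$-th summand $I^\mu_{n-m}A_n(x)\in\mathcal{L}^{(m)}_{HS}(\mathcal{H})$ is evaluated at $m$ copies of $T(x)-x$.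
   Context: $\mathcal{X}$ is a real separable Banach space with Borel $\sigma$-field $\mathcal{B}$; $\mu$ is a centered Gaussian measure on $(\mathcal{X},\mathcal{B})$ with $\operatorname{supp}\mu=\mathcal{X}$; $\mathcal{H}$ is its Cameron–Martin space, i.e. the real separable Hilbert space densely and compactly embedded in $\mathcal{X}$ with $\int_{\mathcal{X}}e^{il(x)}\mu(dx)=e^{-\frac12|l|^2_{\mathcal{H}}}$ for $l\in\mathcal{X}^*$ (with $\mathcal{X}^*$ regarded as a subset of $\mathcal{H}$ by restriction and the Riesz identification). $\mathcal{L}^{(n)}_{HS}(\mathcal{H})$ is the Hilbert space of $n$-linear symmetric Hilbert–Schmidt forms $A_n:\mathcal{H}^n\to\mathbb{R}$ (for $n=0$: $\mathbb{R}$). $\mathcal{L}^{(n)}_{HS,fin}(\mathcal{H})$ is the set of $A_n\in\mathcal{L}^{(n)}_{HS}(\mathcal{H})$ with $A_n(h,\ldots,h)=\prod_{i=1}^d(h,e_i)^{k_i}$, $h\in\mathcal{H}$, for some system $e_1,\dots,e_d\in\mathcal{X}^*$ orthonormal in $\mathcal{H}$ (and $k_1+\dots+k_d=n$); its span is dense in $\mathcal{L}^{(n)}_{HS}(\mathcal{H})$. $H_k(t)=(-1)^ke^{t^2/2}(e^{-t^2/2})^{(k)}$ is the $k$-th Hermite polynomial. $I^\mu_n:\mathcal{L}^{(n)}_{HS}(\mathcal{H})\to L^2(\mathcal{X},\mu)$ is the unique bounded linear map such that for such $A_n\in\mathcal{L}^{(n)}_{HS,fin}(\mathcal{H})$, $I^\mu_nA_n(x)=\prod_{i=1}^dH_{k_i}(e_i(x))$;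 $\frac{1}{\sqrt{n!}}I^\mu_n$ is an isometry onto its image. The same construction applies to forms with values in a real separable Hilbert space $\mathcal{E}$: for a symmetric $k$-linear $\mathcal{E}$-valued Hilbert–Schmidt form $B$ on $\mathcal{H}$, $I^\mu_kB\in L^2(\mathcal{X},\mu;\mathcal{E})$ is characterized by $(I^\mu_kB,u)_{\mathcal{E}}=I^\mu_k\big((B,u)_{\mathcal{E}}\big)$ for $u\in\mathcal{E}$. For $0\le m\le n$, $A_n\in\mathcal{L}^{(n)}_{HS}(\mathcal{H})$ is identified with the symmetric $(n-m)$-linear $\mathcal{L}^{(m)}_{HS}(\mathcal{H})$-valued form $(h_1,\dots,h_{n-m})\mapsto A_n(h_1,\dots,h_{n-m},\cdot,\dots,\cdot)$, and accordingly $I^\mu_{n-m}A_n$ is a $\mu$-square integrable $\mathcal{L}^{(m)}_{HS}(\mathcal{H})$-valued function on $\mathcal{X}$. *)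

(* Defs.v *)
From HB Require Import structures.
From mathcomp Require Import all_boot all_order all_algebra perm.
From mathcomp Require Import all_classical all_reals all_analysis.

Set Implicit Arguments.
Unset Strict Implicit.
Unset Printing Implicit Defensive.
Import Order.TTheory GRing.Theory Num.Theory.
Import numFieldNormedType.Exports.
Local Open Scope classical_set_scope.
Local Open Scope ring_scope.

HB.mixin Record CompleteNormedModule_isHilbert (R : realType) H
    & CompleteNormedModule R H := {
  hdot : H -> H -> R ;
  hdotC : forall x y, hdot x y = hdot y x ;
  hdot_linearl_subproof : forall a x y z,
    hdot (a *: x + y) z = a * hdot x z + hdot y z ;
  hdot_norm : forall x, hdot x x = `|x| ^+ 2
}.

#[short(type="hilbertType")]
HB.structure Definition Hilbert (R : realType) :=
  {H of CompleteNormedModule R H & CompleteNormedModule_isHilbert R H}.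

Lemma hdot_linearl (R : realType) (H : hilbertType R) (a : R) (x y z : H) :
  hdot (a *: x + y) z = a * hdot x z + hdot y z.
Proof. exact: hdot_linearl_subproof. Qed.

Definition separable (T : topologicalType) : Prop :=
  exists2 S : set T, countable S & dense S.

(* The topological space X equipped with its Borel sigma-field; as a bare type
   it is convertible to X. *)
Notation borel X := (g_sigma_algebraType (@open X)).

Section orthonormal_bases.
Context (R : realType) (H : hilbertType R).

Definition is_onb (E : set H) : Prop :=
  (forall e f, E e -> E f -> hdot e f = (e == f)%:R) /\
  (forall h, (forall e, E e -> hdot e h = 0) -> h = 0).

(* A fixed orthonormal basis (it exists by [onb_exists]), used only to write
   Hilbert-Schmidt norms, which do not depend on it. A set rather than a
   sequence, so that finite-dimensional spaces are covered as well. *)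
Definition onb : set H := xget set0 is_onb.

Let ortho (E : set H) : Prop :=
  forall e f, E e -> E f -> hdot e f = (e == f)%:R.

Lemma onb_exists : is_onb onb.
Proof.
suff [E EP] : exists E : set H, is_onb E by exact: (xgetPex set0 (ex_intro _ E EP)).
have [E [oE maxE]] : exists E : set H, ortho E /\
    forall F, E `<` F -> ~ ortho F.
  apply: Zorn_bigcup => C CO Ctot e f [A CA Ae] [B CB Bf].
  have [AB|BA] := Ctot _ _ CA CB.
  - exact: (CO _ CB) (AB _ Ae) Bf.
  - exact: (CO _ CA) Ae (BA _ Bf).
exists E; split => // h hE; apply: contrapT => /eqP h0.
have nh0 : `|h| != 0 by rewrite normr_eq0.
pose u := `|h|^-1 *: h.
have hdotZl a (x y : H) : hdot (a *: x) y = a * hdot x y :> R.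
  have d0 z : hdot (0 : H) z = 0 :> R.
    have /eqP := hdot_linearl (1 : R) (0 : H) 0 z.
    by rewrite scale1r addr0 mul1r -subr_eq0 opprD addNKr oppr_eq0 => /eqP.
  by have := hdot_linearl a x 0 y; rewrite addr0 d0 addr0.
have uE e : E e -> hdot u e = 0 :> R.
  by move=> Ee; rewrite hdotZl hdotC hE// mulr0.
have uu : hdot u u = 1 :> R.
  by rewrite hdotZl hdotC hdotZl hdot_norm expr2 mulKf// mulVf.
apply: (maxE (E `|` [set u])).
  split; first by move=> e Ee; left.
  move=> /(_ u (or_intror erefl)) Eu.
  by have := uE _ Eu; rewrite uu => /eqP; rewrite oner_eq0.
have neq e : E e -> (e == u) = false.
  move=> Ee; apply/eqP => eu; move: (uE _ Ee).
  by rewrite eu uu => /eqP; rewrite oner_eq0.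
move=> e f [Ee|->] [Ef|->].
- exact: oE.
- by rewrite hdotC uE// neq.
- by rewrite uE// eq_sym neq.
- by rewrite uu eqxx.
Qed.

End orthonormal_bases.
Arguments onb {R} H.

Section hilbert_schmidt_forms.
Context (R : realType) (H : hilbertType R).

Definition mform (n : nat) : Type := ('I_n -> H) -> R.

Definition multilinear n (A : mform n) : Prop :=
  forall (v : 'I_n -> H) (i : 'I_n) (a : R) (x y : H),
    A [eta v with i |-> a *: x + y] =
    a * A [eta v with i |-> x] + A [eta v with i |-> y].

Definition symmetric_form n (A : mform n) : Prop :=
  forall (v : 'I_n -> H) (s : 'S_n), A (v \o s) = A v.

(* Boundedness is part of being Hilbert-Schmidt: finiteness of [hs_sqnorm],
   which only sees the values on one basis, does not imply it. *)
Definition bounded_form n (A : mform n) : Prop :=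
  exists C : R, forall v, `|A v| <= C * \prod_(j < n) `|v j|.

Definition onb_tuples n : set ('I_n -> H) := [set v | forall j, onb H (v j)].

Arguments onb_tuples : clear implicits.

Definition hs_sqnorm n (A : mform n) : \bar R :=
  (\esum_(v in onb_tuples n) (A v ^+ 2)%:E)%E.

Definition HSform n : set (mform n) := [set A |
  [/\ multilinear A, symmetric_form A, bounded_form A
    & (hs_sqnorm A < +oo)%E]].

Arguments HSform : clear implicits.

Definition hs_norm n (A : mform n) : R := Num.sqrt (fine (hs_sqnorm A)).

(* The absolutely convergent sum of A v * B v over tuples of basis vectors,
   as the difference of the sums of its positive and negative parts. *)
Definition hs_dot n (A B : mform n) : R :=
  let AB := fun v : 'I_n -> H => (A v * B v)%:E in
  fine (\esum_(v in onb_tuples n) AB^\+%E v)%E -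
  fine (\esum_(v in onb_tuples n) AB^\-%E v)%E.

Definition diag n (h : H) : 'I_n -> H := fun=> h.

Definition cat_vec k m n (e : (k + m)%N = n) (h : 'I_k -> H) (g : 'I_m -> H) :
    'I_n -> H :=
  fun j => match fintype.split (cast_ord (esym e) j) with
           | inl a => h a
           | inr b => g b
           end.

(* An n-linear form seen as a (k + m = n) k-linear form whose values are
   m-linear forms. *)
Definition curry_form k m n (e : (k + m)%N = n) (A : mform n) :
    ('I_k -> H) -> mform m :=
  fun h g => A (cat_vec e h g).

End hilbert_schmidt_forms.
Arguments HSform {R} H n.
Arguments hs_dot {R H n}.

Section gaussian.
Context (R : realType) (X : completeNormedModType R).

(* Degenerate one-dimensional laws are listed apart because [normal_prob]
   with standard deviation 0 is not a Dirac mass. *)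
Definition centered_gaussian (mu : probability (borel X) R) : Prop :=
  forall l : {linear X -> R}, continuous l ->
    (exists2 s : R, s != 0 & forall B : set R, measurable B ->
       mu (l @^-1` B) = normal_prob 0 s B) \/
    (forall B : set R, measurable B -> mu (l @^-1` B) = \d_ (0 : R) B).

Definition measure_support (mu : probability (borel X) R) : set X :=
  [set x | forall U : set X, open U -> U x -> (0 < mu U)%E].

Context (H : hilbertType R) (iota : {linear H -> X}).

(* e is the Riesz representative of the restriction of l to H. *)
Definition riesz_rep (l : {linear X -> R}) (e : H) : Prop :=
  forall h, l (iota h) = hdot h e.

(* iota is the embedding of the Cameron-Martin space of mu; the identity for
   the characteristic function is split into real and imaginary parts. *)
Definition cameron_martin (mu : probability (borel X) R) : Prop :=
  [/\ separable H, injective iota, continuous iota /\ dense (range iota),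
      precompact (iota @` closed_ball (0 : H) 1) &
      forall (l : {linear X -> R}) (e : H), continuous l -> riesz_rep l e ->
        (\int[mu]_x (cos (l x))%:E = (expR (- (`|e| ^+ 2 / 2)))%:E)%E /\
        (\int[mu]_x (sin (l x))%:E = 0)%E].

(* The vector of H corresponding to y in the range of iota. *)
Definition cm_vec (y : X) : H := xget 0 [set h | iota h = y].

End gaussian.

Definition hermite (R : realType) (k : nat) (t : R) : R :=
  (-1) ^+ k * expR (t ^+ 2 / 2) *
  derive1n k (fun s : R => expR (- (s ^+ 2 / 2))) t.

Section multiple_integrals.
Context (R : realType) (X : completeNormedModType R) (H : hilbertType R).
Context (iota : {linear H -> X}) (mu : probability (borel X) R).

(* The n-linear Hilbert-Schmidt form A has A(h,...,h) = prod_j (h, e_j)^(k_j),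
   where e_1, ..., e_d are orthonormal in H and e_j is the functional l_j. *)
Definition is_fin_form n (A : mform H n) d (l : 'I_d -> {linear X -> R})
    (k : 'I_d -> nat) : Prop :=
  exists e : 'I_d -> H,
  [/\ forall j, continuous (l j) /\ riesz_rep iota (l j) (e j),
      forall i j, hdot (e i) (e j) = (i == j)%:R,
      (\sum_(j < d) k j)%N = n,
      HSform H n A
    & forall h, A (diag h) = \prod_(j < d) hdot h (e j) ^+ k j].

(* I is the bounded linear map I^mu_n into L^2(mu), given by representatives;
   its values outside HSform H n are irrelevant. *)
Definition is_multiple_integral n (I : mform H n -> X -> R) : Prop :=
  [/\ forall A, HSform H n A -> (I A : borel X -> R) \in Lfun mu 2%:E,
      forall (a : R) A B, HSform H n A -> HSform H n B ->
        (\forall x \ae mu, I (fun v => a * A v + B v) x = a * I A x + I B x),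
      exists C : R, forall A, HSform H n A ->
        ('N[mu]_2%:E [EFin \o (I A : borel X -> R)] <= (C * hs_norm A)%:E)%E
    & forall A d (l : 'I_d -> {linear X -> R}) (k : 'I_d -> nat),
        is_fin_form A l k ->
        \forall x \ae mu, I A x = \prod_(j < d) hermite (k j) (l j x)].

(* Hilbert-space valued integrals. The value space is a subset E of V with
   inner product dotE; J is a representative of I^mu_k B. *)
Section vector_valued.
Context (V : zmodType) (E : set V) (dotE : V -> V -> R).

Definition norm_open (U : set V) : Prop :=
  U `<=` E /\ forall u, U u -> exists2 r : R, 0 < r &
    forall v, E v -> dotE (v - u) (v - u) < r -> U v.

Definition is_vector_multiple_integral k (I : mform H k -> X -> R)
    (B : ('I_k -> H) -> V) (J : X -> V) : Prop :=
  [/\ forall x, E (J x),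
      forall U, norm_open U -> measurable (J @^-1` U : set (borel X)),
      (\int[mu]_x (dotE (J x) (J x))%:E < +oo)%E
    & forall u, E u ->
        \forall x \ae mu, dotE (J x) u = I (fun h => dotE (B h) u) x].

End vector_valued.

End multiple_integrals.

(* Main.v *)
Require Import Defs.
From HB Require Import structures.
From mathcomp Require Import all_boot all_order all_algebra perm.
From mathcomp Require Import all_classical all_reals all_analysis.
From mathcomp Require Import measurable_realfun ring lra.
Set Implicit Arguments.
Unset Strict Implicit.
Unset Printing Implicit Defensive.
Import Order.TTheory GRing.Theory Num.Theory.
Import numFieldNormedType.Exports.
Local Open Scope classical_set_scope.
Local Open Scope ring_scope.

(** For [A] the [n]-th power of the functional [hdot _ f], with [f] the Riesz
    vector of some [l] in the dual of [X], both sides are explicit: the integral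
    of [A] is the Hermite polynomial of variance [`|f| ^+ 2] evaluated at [l],
    and since [l (T x) = l x + hdot h f] with [h = T x - x], the formula is the
    Taylor expansion of that polynomial. By polarization, truncation in an
    orthonormal basis, and density of these [f] in [H] (Hahn-Banach and
    injectivity of the embedding), linear combinations of such powers are dense
    in the Hilbert-Schmidt forms. If [A_j -> A] fast enough, the integrals of
    all orders converge almost everywhere, in Hilbert-Schmidt norm for the
    vector valued ones; evaluation at [h] is continuous for that norm, and
    "almost everywhere" passes from [mu] to [nu] at [T x] because [nu] is mapped
    to [mu] by [T], and at [x] because [nu] is dominated by [mu]. *)

(** * Hilbert spaces *)

(** The vector-valued integrals at [x] are given only through pairings: for each fixed [u], off a
    null set depending on [u]. Separability of [H] makes them usable. A Hilbert-Schmidt form is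
    determined by its values on basis tuples, these are countably many, and pairing with [sprod w]
    recovers the value at [w] up to a factorial; so [J m x] is known on all basis tuples off one
    null set. The bound for vector-valued integrals comes from the scalar one: by Tonelli, the
    squared integrals of the slices at basis tuples may be summed under the integral, and the
    squared norms of the slices add up to that of the whole form. The shift depends on [x] and is in
    general no basis vector. Evaluation there is controlled by values on the basis because, for
    every [x], the forms are multilinear and bounded, not just square summable ([form_sqr_le]).
    Approximation with squared error 1/2^(j+1) makes the errors summable, so that convergence holds
    almost everywhere along the whole sequence. *)

Section hilbert_basics.
Context (R : realType) (H : hilbertType R).
Implicit Types (x y z h : H) (M : set H).

Lemma hdot0l z : hdot (0 : H) z = 0.
Proof.
have /eqP := hdot_linearl (1 : R) (0 : H) 0 z.
by rewrite scale1r addr0 mul1r -subr_eq0 opprD addNKr oppr_eq0 => /eqP.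
Qed.

Lemma hdotZl a x z : hdot (a *: x) z = a * hdot x z.
Proof. by have := hdot_linearl a x 0 z; rewrite addr0 hdot0l addr0. Qed.

Lemma hdotDl x y z : hdot (x + y) z = hdot x z + hdot y z.
Proof. by have := hdot_linearl 1 x y z; rewrite scale1r mul1r. Qed.

Lemma hdotNl x z : hdot (- x) z = - hdot x z.
Proof. by rewrite -scaleN1r hdotZl mulN1r. Qed.

Lemma hdotBl x y z : hdot (x - y) z = hdot x z - hdot y z.
Proof. by rewrite hdotDl hdotNl. Qed.

Lemma hdot0r z : hdot z (0 : H) = 0.
Proof. by rewrite hdotC hdot0l. Qed.

Lemma hdotZr a x z : hdot z (a *: x) = a * hdot z x.
Proof. by rewrite hdotC hdotZl hdotC. Qed.

Lemma hdotDr x y z : hdot z (x + y) = hdot z x + hdot z y.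
Proof. by rewrite !(hdotC z) hdotDl. Qed.

Lemma hdotBr x y z : hdot z (x - y) = hdot z x - hdot z y.
Proof. by rewrite !(hdotC z) hdotBl. Qed.

Lemma hdot_suml I (r : seq I) (P : pred I) (F : I -> H) z :
  hdot (\sum_(i <- r | P i) F i) z = \sum_(i <- r | P i) hdot (F i) z.
Proof.
by elim/big_rec2 : _ => [|i a b _ <-]; rewrite ?hdot0l// hdotDl.
Qed.

Lemma hdot_sumr I (r : seq I) (P : pred I) (F : I -> H) z :
  hdot z (\sum_(i <- r | P i) F i) = \sum_(i <- r | P i) hdot z (F i).
Proof. by rewrite hdotC hdot_suml; apply: eq_bigr => i _; rewrite hdotC. Qed.

Lemma sqr_normB x y : `|x - y| ^+ 2 = `|x| ^+ 2 - 2 * hdot x y + `|y| ^+ 2.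
Proof. by rewrite -!hdot_norm hdotBl !hdotBr (hdotC y x); ring. Qed.

Lemma cauchy_schwarz x y : `|hdot x y| <= `|x| * `|y|.
Proof.
have [->|y0] := eqVneq y 0; first by rewrite hdot0r normr0 normr0 mulr0.
have ny : 0 < `|y| by rewrite normr_gt0.
rewrite -(@ler_pXn2r _ 2)// ?nnegrE ?mulr_ge0//.
rewrite real_normK ?num_real// exprMn.
pose t := hdot x y / `|y| ^+ 2.
have := sqr_ge0 `|x - t *: y|; rewrite sqr_normB hdotZr normrZ exprMn.
rewrite real_normK ?num_real// => h0.
rewrite -subr_ge0; have -> : `|x| ^+ 2 * `|y| ^+ 2 - hdot x y ^+ 2 =
   `|y| ^+ 2 * (`|x| ^+ 2 - 2 * (t * hdot x y) + t ^+ 2 * `|y| ^+ 2).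
  rewrite /t; field; exact: lt0r_neq0.
by rewrite mulr_ge0// sqr_ge0.
Qed.

Lemma hdot_sqr_le x y : hdot x y ^+ 2 <= `|x| ^+ 2 * `|y| ^+ 2.
Proof.
rewrite -exprMn -real_normK ?num_real//.
by rewrite ler_pXn2r// ?nnegrE ?mulr_ge0// cauchy_schwarz.
Qed.

Definition subspace_pred M :=
  M 0 /\ forall a x y, M x -> M y -> M (a *: x + y).

(** [M] need not be closed, so [p] is only a limit of vectors of [M]. A minimizing sequence for the
    distance to [h] is Cauchy by the parallelogram identity, since midpoints stay in [M]. *)
Lemma orthogonal_projection M (h : H) : subspace_pred M ->
  exists p : H, (forall e, 0 < e -> exists2 m, M m & `|p - m| < e) /\
    (forall m, M m -> hdot (h - p) m = 0).
Proof.
move=> [M0 Mlin].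
have MZ a x : M x -> M (a *: x) by move=> Mx; rewrite -[_ *: _]addr0; exact: Mlin.
have MD x y : M x -> M y -> M (x + y).
  by move=> Mx My; rewrite -[x]scale1r; exact: Mlin.
pose S := [set `|h - m| ^+ 2 | m in M]; pose d := inf S.
have Sinf : has_inf S.
  split; first by exists (`|h - 0| ^+ 2); exists 0.
  by exists 0 => _ [m Mm <-]; exact: sqr_ge0.
have dle m : M m -> d <= `|h - m| ^+ 2.
  by move=> Mm; apply: ge_inf; [exact: Sinf.2|exists m].
have appr (k : nat) : exists m, M m /\ `|h - m| ^+ 2 < d + k.+1%:R^-1.
  have k0 : 0 < k.+1%:R^-1 :> R by rewrite invr_gt0.
  have [_ [m Mm <-] mlt] := inf_adherent k0 Sinf.
  by exists m.
pose u k := sval (cid (appr k)).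
have Mu k : M (u k) by rewrite /u; case: cid => ? [].
have ud k : `|h - u k| ^+ 2 < d + k.+1%:R^-1 by rewrite /u; case: cid => ? [].
have uu j k : `|u j - u k| ^+ 2 <= 2 * j.+1%:R^-1 + 2 * k.+1%:R^-1.
  have Mm : M (2^-1 *: (u j + u k)) by apply: MZ; exact: MD.
  have := dle _ Mm; have := ud j; have := ud k.
  have -> : `|u j - u k| ^+ 2 = 2 * `|h - u j| ^+ 2 + 2 * `|h - u k| ^+ 2
      - 4 * `|h - 2^-1 *: (u j + u k)| ^+ 2.
    rewrite -!hdot_norm !(hdotBl,hdotBr,hdotDl,hdotDr,hdotZl,hdotZr).
    by rewrite (hdotC (u j) h) (hdotC (u k) h) (hdotC (u k) (u j)); field.
  move: (k.+1%:R^-1) (j.+1%:R^-1) => a b h1 h2 h3.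
  by lra.
have ucauchy : cauchy (u @ \oo).
  apply/cauchy_exP => e e0.
  have [N HN] : exists N : nat, 4 * N.+1%:R^-1 < e ^+ 2.
    have e4 : 0 < e ^+ 2 / 4 by rewrite divr_gt0// exprn_gt0.
    have [N _ HN] := near_infty_natSinv_lt (PosNum e4).
    exists N; have /= := HN N (leqnn _).
    by rewrite ltr_pdivlMr// mulrC.
  exists (u N); exists N => // k /= Nk.
  rewrite -ball_normE /=.
  rewrite -(@ltr_pXn2r _ 2)// ?nnegrE// ?ltW//.
  apply: le_lt_trans (uu N k) _; apply: le_lt_trans HN.
  have : k.+1%:R^-1 <= N.+1%:R^-1 :> R by rewrite lef_pV2 ?posrE// ler_nat.
  by move: (k.+1%:R^-1) (N.+1%:R^-1) => a b ab; lra.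
have /cauchy_cvgP/cvg_ex[p up] := ucauchy.
have pM e : 0 < e -> exists2 m, M m & `|p - m| < e.
  move=> e0; move/cvgrPdist_lt : up => /(_ e e0)[N _ HN].
  by exists (u N) => //; exact: HN (leqnn N).
exists p; split => // m Mm.
(* The competitor [t *: m + u k], with [t] the best multiple, lowers the squared distance by c^2 /
   |m|^2, and this gain cannot exceed the slack 1/(k+1) of [u k]. *)
have om k : hdot (h - u k) m ^+ 2 <= k.+1%:R^-1 * `|m| ^+ 2.
  have [->|m0] := eqVneq m 0; first by rewrite hdot0r normr0 expr0n mulr0.
  have nm : 0 < `|m| ^+ 2 by rewrite exprn_gt0// normr_gt0.
  pose c := hdot (h - u k) m; pose t := c / `|m| ^+ 2.
  have /dle : M (t *: m + u k) by exact: Mlin.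
  have -> : h - (t *: m + u k) = (h - u k) - t *: m.
    by rewrite opprD addrA addrAC.
  rewrite sqr_normB normrZ exprMn real_normK ?num_real// hdotZr -/c => h1.
  have := ud k; rewrite -/c.
  have -> : `|h - u k| ^+ 2 = (`|h - u k| ^+ 2 - 2 * (t * c) + t ^+ 2 * `|m| ^+ 2)
     + c ^+ 2 / `|m| ^+ 2 by rewrite /t; field; rewrite normr_eq0.
  by rewrite -ler_pdivrMr//; move: (k.+1%:R^-1) => b h2; lra.
apply/eqP; rewrite -normr_le0; apply/ler_addgt0Pr => e e0; rewrite add0r.
(* Each of the two pieces of [hdot (h - p) m] is bounded by e' |m|, which this choice puts below e /
   2; the added 1 covers m = 0. *)
pose e' := e / (2 * (`|m| + 1)).
have m1 : 0 < `|m| + 1 by rewrite ltr_wpDl.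
have e'0 : 0 < e' by rewrite divr_gt0// mulr_gt0.
have e'2 : 0 < e' ^+ 2 by rewrite exprn_gt0.
move/cvgrPdist_lt : up => /(_ e' e'0)[N1 _ HN1].
have [N2 _ HN2] := near_infty_natSinv_lt (PosNum e'2).
pose k := maxn N1 N2.
have {HN1} pk : `|p - u k| < e' by apply: HN1; exact: leq_maxl.
have {HN2} k2 : k.+1%:R^-1 < e' ^+ 2 by apply: (HN2 k); exact: leq_maxr.
have -> : h - p = (h - u k) - (p - u k) by rewrite opprB addrA subrK.
rewrite hdotBl; apply: le_trans (ler_normB _ _) _.
have a1 : `|hdot (h - u k) m| <= e' * `|m|.
  rewrite -(@ler_pXn2r _ 2)// ?nnegrE//; last by rewrite mulr_ge0// ltW.
  rewrite real_normK ?num_real// exprMn.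
  apply: le_trans (om k) _; apply: ler_wpM2r; first exact: sqr_ge0.
  exact: ltW.
have a2 : `|hdot (p - u k) m| <= e' * `|m|.
  by apply: le_trans (cauchy_schwarz _ _) _; rewrite ler_wpM2r// ltW.
have : e' * `|m| <= e / 2.
  rewrite /e' invfM mulrA -mulrA ler_piMr ?divr_ge0 ?(ltW e0)//.
  by rewrite ler_pdivrMl// mulr1 lerDl.
by lra.
Qed.

Lemma dense_of_orthogonal_trivial M (h : H) : subspace_pred M ->
  (forall y, (forall m, M m -> hdot y m = 0) -> y = 0) ->
  forall e, 0 < e -> exists2 m, M m & `|h - m| < e.
Proof.
move=> Msub Mperp e e0; have [p [pM hp]] := orthogonal_projection h Msub.
by have /eqP := Mperp _ hp; rewrite subr_eq0 => /eqP ->; exact: pM.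
Qed.

(** The projection [p] of [h] is a limit of kernel vectors, and boundedness gives [L p = 0]. Then
    [h - p] is orthogonal to the kernel, and every [x] differs from a multiple of it by a kernel
    vector. *)
Lemma riesz_representation (L : H -> R) :
  (forall a x y, L (a *: x + y) = a * L x + L y) ->
  (exists C, forall x, `|L x| <= C * `|x|) ->
  exists f, forall x, L x = hdot x f.
Proof.
move=> Llin [C LC].
have L0 : L 0 = 0.
  by have := LC 0; rewrite normr0 mulr0 normr_le0 => /eqP.
have LZ a x : L (a *: x) = a * L x by have := Llin a x 0; rewrite L0 !addr0.
have LB x y : L (x - y) = L x - L y.
  by rewrite addrC -scaleN1r Llin mulN1r addrC.
have kersub : subspace_pred [set x | L x = 0].
  by split => // a x y /= Lx Ly; rewrite Llin Lx Ly mulr0 addr0.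
have [Lz|/existsNP[h Lh]] := pselect (forall x, L x = 0).
  by exists 0 => x; rewrite hdot0r.
have [p [pM hp]] := orthogonal_projection h kersub.
have Lp : L p = 0.
  apply/eqP; rewrite -normr_le0; apply/ler_addgt0Pr => e e0; rewrite add0r.
  pose c := `|C| + 1; have c0 : 0 < c by rewrite ltr_wpDl.
  have [m /= Lm pm] := pM (e / c) (divr_gt0 e0 c0).
  have -> : L p = L (p - m) by rewrite LB Lm subr0.
  apply: le_trans (LC _) _.
  apply: (@le_trans _ _ (c * `|p - m|)).
    by rewrite ler_wpM2r// (le_trans (ler_norm _))// /c lerDl.
  by rewrite mulrC -ler_pdivlMr// ltW.
pose y := h - p; have Ly : L y = L h by rewrite LB Lp subr0.
have y0 : y != 0 by apply/eqP => yy; apply: Lh; rewrite -Ly yy.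
have ny : `|y| ^+ 2 != 0 by rewrite expf_neq0// normr_eq0.
exists ((L y / `|y| ^+ 2) *: y) => x.
have : L (x - (L x / L y) *: y) = 0.
  by rewrite LB LZ mulfVK ?subrr// Ly; apply/eqP.
move/hp; rewrite -/y hdotBr hdotZr hdot_norm => /eqP; rewrite subr_eq0 => /eqP yx.
rewrite hdotZr (hdotC x) yx; field.
by rewrite normr_eq0 y0 andbT Ly; apply/eqP.
Qed.

End hilbert_basics.

(** * Finite expansions in the orthonormal basis *)

Section orthonormal_basis.
Context (R : realType) (H : hilbertType R).
Implicit Types (x y z h : H) (s : seq H).

Definition onb_seq s := uniq s /\ {in s, forall e, onb H e}.

Lemma onb_dot e f : onb H e -> onb H f -> hdot e f = (e == f)%:R.
Proof. exact: (onb_exists H).1. Qed.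

Lemma onb_norm e : onb H e -> `|e| ^+ 2 = 1.
Proof. by move=> Ee; rewrite -hdot_norm onb_dot// eqxx. Qed.

Definition onb_proj s x := \sum_(e <- s) hdot x e *: e.

Lemma onb_proj_dot s x f : onb_seq s -> onb H f ->
  hdot (onb_proj s x) f = if f \in s then hdot x f else 0.
Proof.
move=> [us sE] Ef; rewrite hdot_suml; case: ifPn => fs.
  rewrite (bigD1_seq f)//= hdotZl (onb_dot Ef Ef) eqxx mulr1 big1_seq ?addr0// => e.
  by move=> /andP[ef es]; rewrite hdotZl (onb_dot (sE _ es) Ef) (negbTE ef) mulr0.
rewrite big1_seq// => e /= es; rewrite hdotZl (onb_dot (sE _ es) Ef).
by rewrite (_ : e == f = false) ?mulr0//; apply: contraNF fs => /eqP <-.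
Qed.

Lemma sqr_norm_onb_residual s x : onb_seq s ->
  `|x - onb_proj s x| ^+ 2 = `|x| ^+ 2 - \sum_(e <- s) hdot x e ^+ 2.
Proof.
move=> sP; have [us sE] := sP; rewrite sqr_normB -(hdot_norm (onb_proj s x)).
have -> : hdot (onb_proj s x) (onb_proj s x) = \sum_(e <- s) hdot x e ^+ 2.
  rewrite {2}/onb_proj hdot_sumr; apply: eq_big_seq => e es.
  by rewrite hdotZr onb_proj_dot ?es//; exact: sE.
have -> : hdot x (onb_proj s x) = \sum_(e <- s) hdot x e ^+ 2.
  by rewrite hdot_sumr; apply: eq_bigr => e _; rewrite hdotZr.
by ring.
Qed.

Lemma bessel s x : onb_seq s -> \sum_(e <- s) hdot x e ^+ 2 <= `|x| ^+ 2.
Proof.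
by move=> sP; rewrite -subr_ge0 -sqr_norm_onb_residual// sqr_ge0.
Qed.

Lemma onb_projB s x y : onb_proj s (x - y) = onb_proj s x - onb_proj s y.
Proof. by rewrite /onb_proj -sumrB; apply: eq_bigr => e _; rewrite hdotBl scalerBl. Qed.

Lemma onb_proj_lin s a x y : onb_proj s (a *: x + y) = a *: onb_proj s x + onb_proj s y.
Proof.
rewrite /onb_proj scaler_sumr -big_split/=; apply: eq_bigr => e _.
by rewrite hdotDl hdotZl scalerDl scalerA.
Qed.

Lemma parseval_approx x e : 0 < e -> exists2 s, onb_seq s &
  `|x| ^+ 2 <= \sum_(f <- s) hdot x f ^+ 2 + e.
Proof.
(* [M] plays the role of the algebraic span of the basis: vectors fixed by all sufficiently large
   partial projections. Closure under linear combinations then only takes the union of two lists. *)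
pose M := [set m : H | exists s0, onb_seq s0 /\
  forall s, onb_seq s -> {subset s0 <= s} -> onb_proj s m = m].
have Msub : subspace_pred M.
  split.
    exists [::]; split; first by split.
    by move=> s _ _; rewrite /onb_proj big1// => f _; rewrite hdot0l scale0r.
  move=> a m1 m2 [s1 [[u1 E1] P1]] [s2 [[u2 E2] P2]].
  exists (undup (s1 ++ s2)); split.
    split; first exact: undup_uniq.
    by move=> f; rewrite mem_undup mem_cat => /orP[/E1|/E2].
  move=> s sP ss; rewrite onb_proj_lin P1 ?P2// => f fs.
    by apply: ss; rewrite mem_undup mem_cat fs orbT.
  by apply: ss; rewrite mem_undup mem_cat fs.
have ME f : onb H f -> M f.
  move=> Ef; exists [:: f]; split.
    by split => // g; rewrite inE => /eqP ->.
  move=> s [us sE] /(_ f (mem_head _ _)) fs.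
  rewrite /onb_proj (bigD1_seq f)//= onb_dot// eqxx scale1r big1_seq ?addr0//.
  move=> g /andP[gf gs]; rewrite (onb_dot Ef (sE _ gs)).
  by rewrite eq_sym (negbTE gf) scale0r.
have Mperp y : (forall m, M m -> hdot y m = 0) -> y = 0.
  by move=> yM; apply: (onb_exists H).2 => f Ef; rewrite hdotC; apply/yM/ME.
move=> e0; have se0 : 0 < Num.sqrt e by rewrite sqrtr_gt0.
have [m [s0 [s0P mP]] xm] := dense_of_orthogonal_trivial x Msub Mperp se0.
exists s0 => //; rewrite -lerBlDl -sqr_norm_onb_residual//.
(* Since [m] is fixed by the projection, [x] and [x - m] have the same residual, whose norm is at
   most that of [x - m]. *)
have -> : x - onb_proj s0 x = (x - m) - onb_proj s0 (x - m).
  by rewrite onb_projB (mP s0)// opprB addrA subrK.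
rewrite sqr_norm_onb_residual// lerBlDr.
rewrite (@le_trans _ _ e)//; last by rewrite lerDl sumr_ge0// => f _; exact: sqr_ge0.
by rewrite -[leRHS]sqr_sqrtr ?(ltW e0)// ler_pXn2r ?nnegrE ?(ltW se0)// ltW.
Qed.

(** Distinct basis vectors are at squared distance 2, so one point of the dense set cannot lie
    within 1/2 of both; choosing such a point for each basis vector is injective. *)
Lemma onb_countable : separable H -> countable (onb H).
Proof.
move=> [S Scount Sdense].
have ex e : onb H e -> exists y, S y /\ `|e - y| < 1 / 2.
  move=> Ee; have [||y [yb Sy]] := Sdense (ball e (1 / 2)).
  - by exists e; apply: ballxx; rewrite divr_gt0.
  - exact: ball_open.
  - by exists y; split => //; move: yb; rewrite -ball_normE.
pose g e := xget 0 [set y | S y /\ `|e - y| < 1 / 2].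
have gP e : onb H e -> S (g e) /\ `|e - g e| < 1 / 2.
  by move=> /ex [y yP]; exact: (xgetPex (P := [set y | S y /\ `|e - y| < 1 / 2]) 0 (ex_intro _ y yP)).
have ginj : {in onb H &, injective g}.
  move=> e f /set_mem Ee /set_mem Ef gef; apply/eqP/negPn/negP => /negbTE ef.
  have [_ h1] := gP _ Ee; have [_ h2] := gP _ Ef.
  have : `|e - f| < 1.
    have -> : e - f = (e - g e) - (f - g f) by rewrite gef opprB addrA subrK.
    by apply: le_lt_trans (ler_normB _ _) _; lra.
  rewrite ltNge => /negP; apply.
  rewrite -(@ler_pXn2r _ 2)// ?nnegrE// sqr_normB (onb_dot Ee Ef) ef !onb_norm//.
  by rewrite mulr0 subr0 expr1n lerDl.
have gS : g @` onb H `<=` S by move=> _ [e Ee <-]; exact: (gP e Ee).1.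
have : countable (g @` onb H) by exact: sub_countable (subset_card_le gS) Scount.
by rewrite (eq_countable (inj_card_eq ginj)).
Qed.

End orthonormal_basis.

(** * Density of the dual of X in the Cameron-Martin space *)

Section hahn_banach.
Context (R : realType) (X : normedModType R).

(* Partial functionals are represented by their graphs. *)
Definition linear_graph (G : set (X * R)) :=
  G (0, 0) /\ forall a x r y s, G (x, r) -> G (y, s) -> G (a *: x + y, a * r + s).

Definition dominated_graph (G : set (X * R)) := forall x r, G (x, r) -> r <= `|x|.

(** The one-dimensional Hahn-Banach step, [c] being the value given to [y]. Domination of
    differences puts every lower bound -|x + y| - r below every upper bound |x + y| - r, and [c] is
    the supremum of the lower ones. Dividing by [t] reduces the claim to a lower bound if [t] is
    negative, an upper one if positive. *)
Lemma dominated_graph_extension (G : set (X * R)) (y : X) :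
  linear_graph G -> dominated_graph G ->
  exists c, forall x r t, G (x, r) -> r + t * c <= `|x + t *: y|.
Proof.
move=> [G0 Glin] Gdom.
have GZ a x r : G (x, r) -> G (a *: x, a * r).
  by move=> Gx; have := Glin a x r 0 0 Gx G0; rewrite !addr0.
pose S := [set z | exists x r, G (x, r) /\ z = - `|x + y| - r].
have Sub x r : G (x, r) -> ubound S (`|x + y| - r).
  move=> Gx z [x' [r' [Gx' ->]]].
  have /Gdom := Glin (-1) _ _ _ _ Gx' Gx.
  rewrite scaleN1r mulN1r => h.
  have : `|- x' + x| <= `|x + y| + `|x' + y|.
    have -> : - x' + x = (x + y) - (x' + y) by rewrite opprD addrACA subrr addr0 addrC.
    exact: ler_normB.
  by lra.
have Ssup : has_sup S.
  split; first by exists (- `|0 + y| - 0), 0, 0.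
  by exists (`|0 + y| - 0); exact: Sub.
have cl x r : G (x, r) -> - `|x + y| - r <= sup S.
  by move=> Gx; apply: sup_upper_bound => //; exists x, r.
have cu x r : G (x, r) -> sup S <= `|x + y| - r.
  by move=> Gx; apply: ge_sup; [exact: Ssup.1|exact: Sub].
exists (sup S) => x r t Gx.
have [t0|t0|->] := ltgtP t 0; last by rewrite mul0r scale0r !addr0; exact: Gdom.
- have h := cl _ _ (GZ t^-1 _ _ Gx).
  have t0' : t != 0 by rewrite lt_eqF.
  have -> : x + t *: y = t *: (t^-1 *: x + y) by rewrite scalerDr scalerA divff ?scale1r.
  rewrite normrZ ltr0_norm//.
  have -> : r + t * sup S = - t * (- (t^-1 * r) - sup S) by field.
  rewrite ler_wpM2l ?oppr_ge0 ?(ltW t0)//.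
  by move: h; move: (t^-1 * r) => u; lra.
- have h := cu _ _ (GZ t^-1 _ _ Gx).
  have t0' : t != 0 by rewrite gt_eqF.
  have -> : x + t *: y = t *: (t^-1 *: x + y) by rewrite scalerDr scalerA divff ?scale1r.
  rewrite normrZ gtr0_norm//.
  have -> : r + t * sup S = t * (t^-1 * r + sup S) by field.
  rewrite ler_wpM2l ?(ltW t0)//.
  by move: h; move: (t^-1 * r) => u; lra.
Qed.

Lemma hahn_banach_norming (x0 : X) :
  exists l : {linear X -> R}, (forall x, `|l x| <= `|x|) /\ l x0 = `|x0|.
Proof.
pose P (G : set (X * R)) := G = set0 \/
  [/\ linear_graph G, dominated_graph G & G (x0, `|x0|)].
have [A [PA maxA]] : exists A, P A /\ forall B, A `<` B -> ~ P B.
  apply: Zorn_bigcup => F FP Ftot.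
  have [Fe|/existsNP[A0 /not_implyP[FA0 A0n]]] := pselect (forall A, F A -> A = set0).
    left; apply/seteqP; split => // z [A FA]; by rewrite (Fe _ FA).
  have FA A z : F A -> A z ->
      [/\ linear_graph A, dominated_graph A & A (x0, `|x0|)].
    by move=> FA Az; have [A0'|//] := FP _ FA; rewrite A0' in Az.
  have [A0e|[[A00 _] _ A0x]] := FP _ FA0; first by [].
  right; split; last by exists A0.
    split; first by exists A0.
    move=> a x r y s [B FB Bx] [C FC Cy].
    have [BC|CB] := Ftot _ _ FB FC.
      by exists C => //; have [[_ Clin] _ _] := FA _ _ FC Cy; apply: Clin => //; exact: BC.
    by exists B => //; have [[_ Blin] _ _] := FA _ _ FB Bx; apply: Blin => //; exact: CB.
  by move=> x r [B FB Bx]; have [_ Bdom _] := FA _ _ FB Bx; exact: Bdom.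
have {PA} [[A0 Alin] Adom Ax0] :
    [/\ linear_graph A, dominated_graph A & A (x0, `|x0|)].
  case: PA => // A0; exfalso.
  pose B := [set z : X * R | exists t, z = (t *: x0, t * `|x0|)].
  apply: (maxA B).
    rewrite A0; split => // /(_ (0, 0)); apply; exists 0; by rewrite scale0r mul0r.
  right; split.
  - split; first by exists 0; rewrite scale0r mul0r.
    move=> a x r y s [t [-> ->]] [u [-> ->]]; exists (a * t + u).
    by rewrite scalerDl scalerA mulrDl mulrA.
  - move=> x r [t [-> ->]]; rewrite normrZ.
    by rewrite ler_wpM2r// ler_norm.
  - by exists 1; rewrite scale1r mul1r.
have Atot y : exists r, A (y, r).
  apply: contrapT => /forallNP nA.
  have [c cP] := dominated_graph_extension y (conj A0 Alin) Adom.
  pose B := [set z : X * R | exists x r t, A (x, r) /\ z = (x + t *: y, r + t * c)].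
  apply: (maxA B).
    split.
      by move=> [x r] Ax; exists x, r, 0; rewrite scale0r mul0r !addr0.
    move=> BA; apply: (nA c); apply: BA; exists 0, 0, 1.
    by rewrite scale1r mul1r !add0r.
  right; split.
  - split; first by exists 0, 0, 0; rewrite scale0r mul0r !addr0.
    move=> a x r z s [x1 [r1 [t1 [A1 [-> ->]]]]] [x2 [r2 [t2 [A2 [-> ->]]]]].
    exists (a *: x1 + x2), (a * r1 + r2), (a * t1 + t2); split; first exact: Alin.
    congr (_, _); last by ring.
    by rewrite scalerDr scalerDl scalerA addrACA.
  - by move=> x r [x1 [r1 [t1 [A1 [-> ->]]]]]; exact: cP.
  - by exists x0, `|x0|, 0; rewrite scale0r mul0r !addr0.
(* Domination at the vector 0, applied to the difference of the two pairs in both orders, makes the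
   graph single-valued. *)
have Auniq x r s : A (x, r) -> A (x, s) -> r = s.
  move=> Ar As.
  have h1 := Adom _ _ (Alin (-1) _ _ _ _ Ar As).
  have h2 := Adom _ _ (Alin (-1) _ _ _ _ As Ar).
  move: h1 h2; rewrite scaleN1r addNr normr0 !mulN1r => h1 h2.
  by apply/eqP; rewrite eq_le; apply/andP; split; lra.
pose l x := xget 0 [set r | A (x, r)].
have lP x : A (x, l x) by have [r Ar] := Atot x; exact: (xgetPex (P := [set r | A (x, r)]) 0 (ex_intro _ r Ar)).
have llin : linear l.
  by move=> a x y; apply: (Auniq (a *: x + y)) => //; exact: Alin.
pose L : {linear X -> R} := HB.pack l (GRing.isLinear.Build R X R _ l llin).
exists L; split => [x|]; last exact: (Auniq x0).
rewrite ler_norml; apply/andP; split; last exact: Adom.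
rewrite lerNl; have := Adom _ _ (Alin (-1) _ _ _ _ (lP x) A0).
by rewrite !addr0 scaleN1r mulN1r normrN.
Qed.

End hahn_banach.

Section cameron_martin_dual.
Context (R : realType) (X : completeNormedModType R).
Context (H : hilbertType R) (iota : {linear H -> X}).

Definition dual_vec : set H :=
  [set f | exists2 l : {linear X -> R}, continuous l & riesz_rep iota l f].

(** If [y] is orthogonal to all dual vectors, take a functional norming [iota y]: its Riesz vector
    on [H] is a dual vector, so |iota y| = 0 and injectivity gives y = 0. *)
Lemma dual_vec_dense (h : H) : injective iota -> continuous iota ->
  forall e, 0 < e -> exists2 f, dual_vec f & `|h - f| < e.
Proof.
move=> iota_inj iota_cont; apply: dense_of_orthogonal_trivial.
  split.
    exists (\0 : {linear X -> R}); first by move=> x; exact: cvg_cst.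
    by move=> x; rewrite hdot0r.
  move=> a f g [l lc lf] [l' lc' lg].
  have Llin : linear (fun x => a * l x + l' x).
    by move=> b x y; rewrite !linearP/= /GRing.scale/=; ring.
  pose L : {linear X -> R} := HB.pack (fun x => a * l x + l' x)
    (GRing.isLinear.Build R X R _ _ Llin).
  exists L.
    move=> x; apply: (@cvgD _ _ _ _ _ (fun x => a * l x) l'); last exact: lc'.
    by apply: cvgM; [exact: cvg_cst|exact: lc].
  by move=> x; rewrite hdotDr hdotZr /L/= lf lg.
move=> y yD; apply: iota_inj; rewrite linear0; apply/eqP; rewrite -normr_eq0; apply/eqP.
have [l [ldom <-]] := hahn_banach_norming (iota y).
have lc : continuous l.
  apply: bounded_linear_continuous; apply/linear_boundedP.
  by exists 1; split => // r r1 x; apply: le_trans (ldom x) _; rewrite ler_peMl// ltW.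
have /linear_boundedP/pinfty_ex_gt0[C C0 iotaC] :=
  continuous_linear_bounded 0 (iota_cont 0).
have [f lf] : exists f, forall x, l (iota x) = hdot x f.
  apply: riesz_representation; first by move=> a x z; rewrite !linearP.
  by exists C => x; apply: le_trans (ldom _) (iotaC x).
by rewrite lf; apply: yD; exists l.
Qed.

End cameron_martin_dual.

(** * Hilbert-Schmidt forms *)

Section esum_facts.
Context (R : realType) (T : choiceType).
Implicit Types (S : set T) (a : T -> \bar R).
Local Open Scope ereal_scope.

Lemma esum_le_seq S a x :
  (forall s : seq T, uniq s -> {in s, forall i, S i} -> \sum_(i <- s) a i <= x) ->
  \esum_(i in S) a i <= x.
Proof.
move=> ax; apply: ge_ereal_sup => _ [A [finA AS] <-].
rewrite fsbig_finite//; apply: ax => // i; rewrite in_fset_set// => /set_mem; exact: AS.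
Qed.

Lemma esum_ge_seq S a (s : seq T) : uniq s -> {in s, forall i, S i} ->
  \sum_(i <- s) a i <= \esum_(i in S) a i.
Proof.
move=> us sS; apply: esum_ge; exists [set` s]; last by rewrite -fsbig_seq.
by split => // i /=; exact: sS.
Qed.

Lemma esum_ge1 S a i : S i -> a i <= \esum_(i in S) a i.
Proof.
move=> Si; have := @esum_ge_seq S a [:: i] isT; rewrite big_seq1; apply.
by move=> j; rewrite inE => /eqP ->.
Qed.

Lemma esumZl S a (c : R) : (0 <= c)%R -> (forall i, 0 <= a i) ->
  \esum_(i in S) (c%:E * a i) = c%:E * \esum_(i in S) a i.
Proof.
move=> c0 a0; rewrite /esum -ereal_supZl//; last first.
  by apply/set0P; exists (\sum_(i \in set0) a i), set0 => //; exact: fsets_set0.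
congr ereal_sup; rewrite image_comp; apply: eq_imagel => A [finA AS]/=.
by rewrite ge0_mule_fsumr.
Qed.

(** A finite list whose sum is within [e] of the total works: any finite list disjoint from it can
    be appended without exceeding the total. It serves both to truncate forms and to make the terms
    of a convergent series small. *)
Lemma esum_tail S a (e : R) : (forall i, 0 <= a i) ->
  \esum_(i in S) a i < +oo -> (0 < e)%R ->
  exists s : seq T, [/\ uniq s, {in s, forall i, S i} &
    forall D : set T, (forall i, D i -> S i /\ i \notin s) ->
      \esum_(i in D) a i <= e%:E].
Proof.
move=> a0 afin e0.
have fn : \esum_(i in S) a i \is a fin_num by rewrite ge0_fin_numE// esum_ge0.
have [_ [A [finA AS] <-]] := ub_ereal_sup_adherent e0 fn.
rewrite -/(esum S a) fsbig_finite// => Ae.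
exists (finmap.enum_fset (fset_set A)); split => // [i|D DS].
  by rewrite in_fset_set// => /set_mem; exact: AS.
apply: esum_le_seq => t ut tD.
have := @esum_ge_seq S a (finmap.enum_fset (fset_set A) ++ t).
rewrite cat_uniq finmap.fset_uniq ut andbT/= => h.
have {}h : \sum_(i <- finmap.enum_fset (fset_set A) ++ t) a i <= \esum_(i in S) a i.
  apply: h.
    by apply/hasPn => i /tD /DS[_].
  move=> i; rewrite mem_cat => /orP[|/tD/DS[]//].
  by rewrite in_fset_set// => /set_mem; exact: AS.
rewrite big_cat/= in h.
have fA : \sum_(i <- finmap.enum_fset (fset_set A)) a i \is a fin_num.
  rewrite ge0_fin_numE ?sume_ge0//; apply: le_lt_trans afin.
  by apply: le_trans h; rewrite leeDl// sume_ge0.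
have ft : \sum_(i <- t) a i \is a fin_num.
  rewrite ge0_fin_numE ?sume_ge0//; apply: le_lt_trans afin.
  by apply: le_trans h; rewrite leeDr// sume_ge0.
move: Ae h fn; rewrite -(fineK fA) -(fineK ft); case: (\esum_(i in S) a i) => // r.
by rewrite -EFinB -EFinD !lte_fin !lee_fin => h1 h2 _; lra.
Qed.

End esum_facts.

(** Fubini for sums along a bijective pairing; [c] is either a head joined to a tail or the
    concatenation of two tuples. *)
Lemma esum_pair (R : realType) (T1 T2 T : choiceType) (S1 : set T1) (S2 : set T2)
    (S : set T) (c : T1 -> T2 -> T) (a : T -> \bar R) :
  (forall t, (0 <= a t)%E) ->
  (forall x y, S1 x -> S2 y -> S (c x y)) ->
  (forall x y x' y', c x y = c x' y' -> x = x' /\ y = y') ->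
  (forall t, S t -> exists x y, [/\ S1 x, S2 y & t = c x y]) ->
  \esum_(t in S) a t = \esum_(x in S1) \esum_(y in S2) a (c x y).
Proof.
move=> a0 cS cinj csurj; rewrite esum_esum//.
rewrite (reindex_esum (S1 `*`` (fun=> S2)) S (fun z => c z.1 z.2))//.
split.
- by move=> [x y] [/= Sx Sy]; exact: cS.
- by move=> [x y] [x' y'] _ _ /= /cinj[-> ->].
- by move=> t /csurj[x [y [Sx Sy ->]]]; exists (x, y).
Qed.

(** * Norm bounds for forms and tensor powers *)

Section forms.
Context (R : realType) (H : hilbertType R).
Implicit Types (f g h x y : H).

Definition fcons n (x : H) (w : 'I_n -> H) : 'I_n.+1 -> H :=
  fun i => oapp w x (unlift ord0 i).

Lemma fcons0 n x (w : 'I_n -> H) : fcons x w ord0 = x.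
Proof. by rewrite /fcons unlift_none. Qed.

Lemma fconsS n x (w : 'I_n -> H) i : fcons x w (lift ord0 i) = w i.
Proof. by rewrite /fcons liftK. Qed.

Lemma fcons_eta n (v : 'I_n.+1 -> H) : v = fcons (v ord0) (v \o lift ord0).
Proof.
by apply/funext => i; case: (unliftP ord0 i) => [j ->|->]; rewrite ?fcons0 ?fconsS.
Qed.

Lemma fcons_upd0 n x y (w : 'I_n -> H) : fcons y w = [eta fcons x w with ord0 |-> y].
Proof.
by apply/funext => i /=; case: (unliftP ord0 i) => [j ->|->]; rewrite ?fcons0 ?fconsS.
Qed.

Lemma fcons_updS n x y (w : 'I_n -> H) i :
  fcons x [eta w with i |-> y] = [eta fcons x w with lift ord0 i |-> y].
Proof.
apply/funext => k /=; case: (unliftP ord0 k) => [j ->|->]; rewrite ?fcons0 ?fconsS//=.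
Qed.

Lemma esum_onb_tuples0 (a : ('I_0 -> H) -> \bar R) v : (0 <= a v)%E ->
  (\esum_(w in onb_tuples (n:=0)) a w)%E = a v.
Proof.
move=> av; have -> : onb_tuples (n:=0) = [set v] :> set ('I_0 -> H).
  apply/seteqP; split => w; last by move=> _ [].
  by move=> _; apply/funext => -[].
exact: esum_set1.
Qed.

Lemma esum_onb_tuplesS n (a : ('I_n.+1 -> H) -> \bar R) : (forall v, (0 <= a v)%E) ->
  (\esum_(v in onb_tuples (n:=n.+1)) a v =
   \esum_(w in onb_tuples (n:=n)) \esum_(x in onb H) a (fcons x w))%E.
Proof.
move=> a0; apply: (esum_pair (c := fun w x => fcons x w)) => //.
- move=> w x Ew Ex j; case: (unliftP ord0 j) => [k ->|->]; rewrite ?fcons0 ?fconsS//; exact: Ew.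
- move=> w x w' x' e; split; last by have := congr1 (@^~ ord0) e; rewrite /= !fcons0.
  by apply/funext => i; have := congr1 (@^~ (lift ord0 i)) e; rewrite /= !fconsS.
- move=> v Ev; exists (v \o lift ord0), (v ord0); split => //; first by move=> j; exact: Ev.
  exact: fcons_eta.
Qed.

Lemma sqre_ge0 (r : R) : (0 <= (r ^+ 2)%:E)%E.
Proof. by rewrite lee_fin sqr_ge0. Qed.
Hint Resolve sqre_ge0 : core.

Lemma hs_sqnorm_ge0 n (A : mform H n) : (0 <= hs_sqnorm A)%E.
Proof. exact: esum_ge0. Qed.

(** Pointwise (x + y)^2 <= 2 x^2 + 2 y^2. This crude substitute for the triangle inequality stays
    with squared norms in the extended reals and accounts for the factors 2 and the choices [e / 4]
    further on. *)
Lemma hs_sqnorm_lin n a (A B : mform H n) :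
  (hs_sqnorm (fun v => (a * A v + B v)%R) <=
   (2 * a ^+ 2)%:E * hs_sqnorm A + 2%:E * hs_sqnorm B)%E.
Proof.
have a2 : 0 <= 2 * a ^+ 2 by rewrite mulr_ge0// sqr_ge0.
rewrite /hs_sqnorm -!esumZl// -esumD; last 2 first.
- by move=> v _; rewrite mule_ge0// lee_fin.
- by move=> v _; rewrite mule_ge0// lee_fin.
apply: le_esum => v _; rewrite -!EFinM -EFinD lee_fin -subr_ge0.
have -> : 2 * a ^+ 2 * A v ^+ 2 + 2 * B v ^+ 2 - (a * A v + B v) ^+ 2 =
  (a * A v - B v) ^+ 2 by ring.
exact: sqr_ge0.
Qed.

Lemma hs_sqnormB n (A B : mform H n) :
  (hs_sqnorm (fun v => (A v - B v)%R) <= 2%:E * hs_sqnorm A + 2%:E * hs_sqnorm B)%E.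
Proof.
rewrite addeC; have := hs_sqnorm_lin (-1) B A; rewrite sqrrN expr1n mulr1.
by under eq_fun do rewrite mulN1r addrC.
Qed.

Lemma HSform_lin n a (A B : mform H n) : HSform H n A -> HSform H n B ->
  HSform H n (fun v => a * A v + B v).
Proof.
move=> [Al As [C1 Ab] Af] [Bl Bs [C2 Bb] Bf]; split.
- by move=> v i b x y; rewrite Al Bl; ring.
- by move=> v s; rewrite As Bs.
- exists (`|a| * C1 + C2) => v; apply: le_trans (ler_normD _ _) _.
  by rewrite normrM mulrDl -mulrA lerD// ler_wpM2l.
- apply: le_lt_trans (hs_sqnorm_lin _ _ _) _.
  have a2 : 0 <= 2 * a ^+ 2 by rewrite mulr_ge0// sqr_ge0.
  by apply: lte_add_pinfty; rewrite lte_mul_pinfty// lee_fin.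
Qed.

Lemma HSform0 n : HSform H n (fun=> 0).
Proof.
split => //.
- by move=> v i a x y; rewrite mulr0 addr0.
- by exists 0 => v; rewrite normr0 mul0r.
- by rewrite /hs_sqnorm esum1// => v _; rewrite expr0n.
Qed.

Lemma HSformZ n a (A : mform H n) : HSform H n A -> HSform H n (fun v => a * A v).
Proof.
move=> HA; have := HSform_lin a HA (HSform0 n).
by under eq_fun do rewrite addr0.
Qed.

Lemma HSformB n (A B : mform H n) : HSform H n A -> HSform H n B ->
  HSform H n (fun v => A v - B v).
Proof.
move=> HA HB; have := HSform_lin (-1) HB HA.
by under eq_fun do rewrite mulN1r addrC.
Qed.

(** With [r] the Riesz vector of [L], the left side is at most |r|^2, which is the right side by
    Parseval. *)
Lemma linear_sqr_le_esum (L : H -> R) h :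
  (forall a x y, L (a *: x + y) = a * L x + L y) ->
  (exists C, forall x, `|L x| <= C * `|x|) -> `|h| <= 1 ->
  ((L h ^+ 2)%:E <= \esum_(x in onb H) (L x ^+ 2)%:E)%E.
Proof.
move=> Ll Lb h1; have [r Lr] := riesz_representation Ll Lb.
apply: (@le_trans _ _ (`|r| ^+ 2)%:E).
  rewrite lee_fin Lr; apply: le_trans (hdot_sqr_le _ _) _.
  by rewrite ler_piMl ?sqr_ge0// expr_le1.
apply/lee_addgt0Pr => e e0; have [s [us sE] rs] := parseval_approx r e0.
apply: (@le_trans _ _ (\sum_(f <- s) (L f ^+ 2)%:E + e%:E)%E); last first.
  by rewrite leeD2r// esum_ge_seq.
rewrite sumEFin -EFinD lee_fin; apply: le_trans rs _; rewrite lerD2r.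
by apply: ler_sum => f _; rewrite Lr hdotC.
Qed.

(** The operator norm is at most the Hilbert-Schmidt norm. By induction, the head argument is frozen
    and the others are replaced by basis vectors; then, for each basis tuple, the linear case treats
    the head slot. Boundedness is what lets Riesz apply there. *)
Lemma form_sqr_le n (A : mform H n) (v : 'I_n -> H) :
  multilinear A -> bounded_form A -> (forall j, `|v j| <= 1) ->
  ((A v ^+ 2)%:E <= hs_sqnorm A)%E.
Proof.
elim: n A v => [|n IH] A v Al Ab v1.
  by apply: (@esum_ge1 _ _ _ (fun w => (A w ^+ 2)%:E)); case.
rewrite /hs_sqnorm esum_onb_tuplesS// (fcons_eta v).
have [C AC] := Ab.
apply: (@le_trans _ _ (hs_sqnorm (fun w => A (fcons (v ord0) w)))).
  apply: (IH (fun w => A (fcons (v ord0) w))) => //.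
  - by move=> w i a x y; rewrite !fcons_updS Al.
  - exists (C * `|v ord0|) => w; apply: le_trans (AC _) _.
    by rewrite big_ord_recl fcons0 mulrA; under eq_bigr do rewrite fconsS.
  - by move=> j; exact: v1.
apply: le_esum => w _; apply: linear_sqr_le_esum => //.
  move=> a x y; have := Al (fcons 0 w) ord0 a x y.
  by rewrite -!fcons_upd0.
exists (C * \prod_(j < n) `|w j|) => x; apply: le_trans (AC _) _.
rewrite big_ord_recl fcons0 -mulrA [in leRHS](mulrC _ `|x|).
by under eq_bigr do rewrite fconsS.
Qed.

Definition form_pow n f : mform H n := fun v => \prod_(j < n) hdot (v j) f.

Lemma multilinear_pow n f : multilinear (form_pow (n:=n) f).
Proof.
move=> v i a x y.
have E z : form_pow f [eta v with i |-> z] = hdot z f * \prod_(j < n | j != i) hdot (v j) f.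
  rewrite /form_pow (bigD1 i)//= eqxx; congr (_ * _).
  by apply: eq_bigr => j /negbTE ->.
by rewrite !E hdot_linearl mulrDl mulrA.
Qed.

Lemma symmetric_pow n f : Defs.symmetric_form (form_pow (n:=n) f).
Proof. by move=> v s; rewrite /form_pow [RHS](reindex_inj (@perm_inj _ s)). Qed.

Lemma bounded_pow n f : bounded_form (form_pow (n:=n) f).
Proof.
exists (`|f| ^+ n) => v; rewrite normr_prod.
apply: (@le_trans _ _ (\prod_(j < n) (`|f| * `|v j|))).
  by apply: ler_prod => j _; rewrite normr_ge0 mulrC cauchy_schwarz.
by rewrite big_split/= prodr_const card_ord.
Qed.

(** Summing first over the head slot gives at most |f|^2, by Bessel. *)
Lemma hs_sqnorm_tensor n f (B : mform H n) :
  (hs_sqnorm (fun v : 'I_n.+1 -> H => (hdot (v ord0) f * B (v \o lift ord0))%R) <=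
   (`|f| ^+ 2)%:E * hs_sqnorm B)%E.
Proof.
rewrite /hs_sqnorm esum_onb_tuplesS// -esumZl ?sqr_ge0//.
apply: le_esum => w _.
apply: esum_le_seq => s us sE.
under eq_bigr.
  move=> x _; rewrite fcons0 (_ : _ \o _ = w); first over.
  by apply/funext => j /=; rewrite fconsS.
rewrite sumEFin -EFinM lee_fin.
under eq_bigr do rewrite exprMn hdotC.
by rewrite -mulr_suml ler_wpM2r ?sqr_ge0//; exact: bessel.
Qed.

Lemma form_powS n f : form_pow (n:=n.+1) f =
  fun v => hdot (v ord0) f * form_pow (n:=n) f (v \o lift ord0).
Proof. by apply/funext => v; rewrite /form_pow big_ord_recl. Qed.

Lemma hs_sqnorm_pow n f : (hs_sqnorm (form_pow (n:=n) f) <= ((`|f| ^+ 2) ^+ n)%:E)%E.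
Proof.
elim: n => [|n IH].
  rewrite /hs_sqnorm (esum_onb_tuples0 (v := fun=> 0))//.
  by rewrite /form_pow big_ord0 expr1n expr0.
rewrite form_powS; apply: le_trans (hs_sqnorm_tensor _ _) _.
rewrite [X in (_ <= X%:E)%E]exprS [leRHS]EFinM; apply: lee_wpmul2l => //.
Qed.

Lemma HSform_pow n f : HSform H n (form_pow (n:=n) f).
Proof.
split; [exact: multilinear_pow|exact: symmetric_pow|exact: bounded_pow|].
by apply: le_lt_trans (hs_sqnorm_pow _ _) _; rewrite ltry.
Qed.

(** Tensor powers are Lipschitz on balls: the difference of order n + 1 is f times the difference of
    order n, plus (f - g) times the power of g. The constant thus obeys C' = 2 M C + 2 M^n and
    depends only on [n] and [M]. *)
Lemma hs_sqnorm_powB n (M : R) : 0 <= M -> exists2 C, 0 <= C & forall f g,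
  `|f| ^+ 2 <= M -> `|g| ^+ 2 <= M ->
  (hs_sqnorm (fun v => (form_pow (n:=n) f v - form_pow (n:=n) g v)%R)
    <= (C * `|f - g| ^+ 2)%:E)%E.
Proof.
move=> M0; elim: n => [|n [C C0 IH]].
  exists 0 => // f g _ _; rewrite /hs_sqnorm esum1 ?mul0r// => v _.
  by rewrite /form_pow !big_ord0 subrr expr0n.
exists (2 * (M * C) + 2 * M ^+ n) => [|f g fM gM].
  by rewrite addr_ge0// mulr_ge0// ?mulr_ge0// exprn_ge0.
have -> : (fun v : 'I_n.+1 -> H => form_pow f v - form_pow g v) =
  (fun v => hdot (v ord0) f * (fun w => form_pow f w - form_pow g w) (v \o lift ord0) -
     hdot (v ord0) (g - f) * form_pow g (v \o lift ord0)).
  by apply/funext => v; rewrite !form_powS hdotBr; ring.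
apply: le_trans (hs_sqnormB _ _) _.
set D := fun w : 'I_n -> H => form_pow f w - form_pow g w.
apply: (@le_trans _ _ (2%:E * (M * (C * `|f - g| ^+ 2))%:E +
    2%:E * (`|f - g| ^+ 2 * M ^+ n)%:E)%E).
  apply: leeD; apply: lee_wpmul2l; rewrite ?lee_fin//.
    apply: le_trans (hs_sqnorm_tensor f D) _.
    apply: le_trans (lee_wpmul2l _ (IH f g fM gM)) _; first exact: sqre_ge0.
    by rewrite -EFinM lee_fin ler_wpM2r// mulr_ge0// sqr_ge0.
  apply: le_trans (hs_sqnorm_tensor (g - f) _) _.
  apply: le_trans (lee_wpmul2l _ (hs_sqnorm_pow n g)) _; first exact: sqre_ge0.
  by rewrite distrC -EFinM lee_fin ler_wpM2l ?sqr_ge0// lerXn2r// ?nnegrE ?sqr_ge0.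
by rewrite -!EFinM -EFinD lee_fin le_eqVlt; apply/orP; left; apply/eqP; ring.
Qed.

End forms.

(** * Polarization and density of powers *)

Section polarization.
Context (R : realType) (H : hilbertType R).
Implicit Types (f g h x y : H).

(* [n`!] times the symmetrization of the product of the functionals [hdot _ (v j)]. *)
Definition sprod n (v : 'I_n -> H) : mform H n :=
  fun w => \sum_(s : 'S_n) \prod_(j < n) hdot (w j) (v (s j)).

Definition pow_sum n (s : seq (R * H)) : mform H n :=
  fun v => \sum_(p <- s) p.1 * form_pow (n:=n) p.2 v.

(** The sign of [i] occurs 1 + |fibre of f over i| times, so the sum factors over [i], with factor 2
    for an odd fibre and 0 for an even one. An injective [f] has all fibres of size 1; otherwise
    some fibre is empty. *)
Lemma sum_signs n (f : {ffun 'I_n -> 'I_n}) :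
  \sum_(eps : {ffun 'I_n -> bool})
    (\prod_i (-1) ^+ eps i) * \prod_j (-1) ^+ eps (f j) =
  (if injectiveb f then 2 ^+ n else 0) :> R.
Proof.
have E (eps : {ffun 'I_n -> bool}) :
    (\prod_i (-1) ^+ eps i) * \prod_j (-1) ^+ eps (f j) =
    \prod_i (-1) ^+ (eps i * #|[pred j | f j == i]|.+1) :> R.
  have -> : \prod_j (-1) ^+ eps (f j) =
      \prod_i (-1) ^+ (eps i * #|[pred j | f j == i]|) :> R.
    rewrite (partition_big f xpredT)//=; apply: eq_bigr => i _.
    rewrite (eq_bigr (fun=> (-1) ^+ eps i)); last by move=> j /eqP ->.
    by rewrite prodr_const -exprM.
  by rewrite -big_split/=; apply: eq_bigr => i _; rewrite -exprD mulnS.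
under eq_bigr do rewrite E.
rewrite -(bigA_distr_bigA (fun i (b : bool) => (-1) ^+ (b * #|[pred j | f j == i]|.+1))).
have S2 i : \sum_(b : bool) (-1) ^+ (b * #|[pred j | f j == i]|.+1) =
    1 - (-1) ^+ #|[pred j | f j == i]| :> R.
  by rewrite big_bool/= mul0n mul1n expr0 exprS mulN1r addrC.
under eq_bigr do rewrite S2.
case: ifPn => [/injectiveP finj|fninj].
  have c1 i : #|[pred j | f j == i]| = 1%N.
    have [g fg gf] := injF_bij finj.
    rewrite -(card1 (g i)); apply: eq_card => j; rewrite !inE.
    by apply/eqP/eqP => [<-|->]; rewrite ?fg ?gf.
  by rewrite (eq_bigr (fun=> 2)) ?prodr_const ?card_ord// => i _; rewrite c1; ring.
have [i fi] : exists i, #|[pred j | f j == i]| = 0%N.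
  apply: contrapT => /forallNP h; move/negP : fninj; apply; apply/injectiveP.
  have g_ex i : exists j, f j == i.
    by have /eqP := h i; rewrite -lt0n => /card_gt0P[j]; rewrite inE; exists j.
  pose g i := xchoose (g_ex i).
  have fg : cancel g f by move=> i; apply/eqP; exact: (xchooseP (g_ex i)).
  have [k gk kg] := injF_bij (can_inj fg).
  by move=> x y; rewrite -(kg x) -(kg y) !fg => ->.
by rewrite (bigD1 i)//= fi expr0 subrr mul0r.
Qed.

(** The polarization identity: the power of a signed sum expands over all maps f from indices to
    indices, and averaging against the signs keeps only the permutations. *)
Lemma sprodE n (v : 'I_n -> H) w : sprod v w =
  2 ^- n * \sum_(eps : {ffun 'I_n -> bool}) (\prod_i (-1) ^+ eps i) *
    form_pow (n:=n) (\sum_i (-1) ^+ eps i *: v i) w.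
Proof.
have E (eps : {ffun 'I_n -> bool}) :
    form_pow (n:=n) (\sum_i (-1) ^+ eps i *: v i) w =
    \sum_(f : {ffun 'I_n -> 'I_n})
      (\prod_j (-1) ^+ eps (f j)) * \prod_j hdot (w j) (v (f j)).
  rewrite /form_pow; under eq_bigr do rewrite hdot_sumr.
  rewrite bigA_distr_bigA; apply: eq_bigr => f _.
  by rewrite -big_split/=; apply: eq_bigr => j _; rewrite hdotZr.
under eq_bigr do rewrite E big_distrr/=.
rewrite exchange_big/=.
have E2 (f : {ffun 'I_n -> 'I_n}) :
    \sum_(eps : {ffun 'I_n -> bool}) (\prod_i (-1) ^+ eps i) *
      ((\prod_j (-1) ^+ eps (f j)) * \prod_j hdot (w j) (v (f j))) =
    if injectiveb f then 2 ^+ n * \prod_j hdot (w j) (v (f j)) else 0.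
  rewrite (eq_bigr (fun eps : {ffun 'I_n -> bool} => (\prod_i (-1) ^+ eps i) *
    (\prod_j (-1) ^+ eps (f j)) * \prod_j hdot (w j) (v (f j)))).
    by rewrite -big_distrl/= sum_signs; case: ifP; rewrite ?mul0r.
  by move=> eps _; rewrite mulrA.
under eq_bigr do rewrite E2.
rewrite -big_mkcond/= -big_distrr/= mulKf ?expf_neq0//.
(* Permutations reindex the injective finite functions; the identity is the default of [insubd] on
   the other ones. *)
rewrite (reindex (@pval _)) /=; last first.
  pose in_Sn := insubd (1%g : 'S_n).
  by exists in_Sn => /= f Uf; first apply: val_inj; exact: insubdK.
by apply: eq_big => [s|s _]; rewrite ?(valP s)// pvalE.
Qed.

Lemma pow_sum_lin n a (s t : seq (R * H)) : exists u, forall v,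
  pow_sum (n:=n) u v = a * pow_sum (n:=n) s v + pow_sum (n:=n) t v.
Proof.
exists ([seq (a * p.1, p.2) | p <- s] ++ t) => v.
rewrite /pow_sum big_cat/= big_map; congr (_ + _).
by rewrite big_distrr/=; apply: eq_bigr => p _; rewrite mulrA.
Qed.

Lemma pow_sum_big n I (r : seq I) (c : I -> R) (F : I -> mform H n) :
  (forall i, exists s, forall v, F i v = pow_sum s v) ->
  exists s, forall v, \sum_(i <- r) c i * F i v = pow_sum (n:=n) s v.
Proof.
move=> Fs; elim: r => [|i r [s IH]].
  by exists [::] => v; rewrite /pow_sum !big_nil.
have [t Ft] := Fs i; have [u uP] := pow_sum_lin n (c i) t s.
by exists u => v; rewrite big_cons uP IH Ft.
Qed.

Lemma sprod_pow_sum n (v : 'I_n -> H) :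
  exists s, forall w, sprod v w = pow_sum (n:=n) s w.
Proof.
have powP (f : H) : exists s, forall w, form_pow (n:=n) f w = pow_sum s w.
  by exists [:: (1, f)] => w; rewrite /pow_sum big_seq1 mul1r.
have [s sP] := pow_sum_big (index_enum {ffun 'I_n -> bool})
  (fun eps => 2 ^- n * \prod_i (-1) ^+ eps i)
  (fun eps => powP (\sum_i (-1) ^+ eps i *: v i)).
exists s => w; rewrite -sP sprodE big_distrr/=.
by apply: eq_bigr => eps _; rewrite mulrA.
Qed.

Lemma HSform_pow_sum n s : HSform H n (pow_sum (n:=n) s).
Proof.
elim: s => [|p s IH]; rewrite /pow_sum.
  by under eq_fun do rewrite big_nil; exact: HSform0.
under eq_fun do rewrite big_cons.
by apply: HSform_lin => //; exact: HSform_pow.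
Qed.

Lemma HSform_sprod n (v : 'I_n -> H) : HSform H n (sprod v).
Proof.
have [s /funext ->] := sprod_pow_sum v; exact: HSform_pow_sum.
Qed.

(** If [v] has repeated entries several permutations count, so the value is the order of a
    stabilizer, not just 0 or 1. *)
Lemma sprod_onb n (v w : 'I_n -> H) : onb_tuples v -> onb_tuples w ->
  sprod v w = \sum_(s : 'S_n) (w == v \o s)%:R.
Proof.
move=> Ev Ew; apply: eq_bigr => s _.
have [->|/eqP wv] := eqVneq w (v \o s).
  by rewrite big1// => j _; rewrite onb_dot//= eqxx.
have [j wvj] : exists j, w j != v (s j).
  by apply: contrapT => /forallNP h; apply: wv; apply/funext => j; apply/eqP/negPn/negP/h.
by rewrite (bigD1 j)//= onb_dot// (negbTE wvj) mul0r.
Qed.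

Lemma comp_perm_eq n (v w : 'I_n -> H) (s : 'S_n) :
  (w == v \o s) = (v == w \o (s^-1)%g).
Proof.
by apply/eqP/eqP => ->; apply/funext => j /=; rewrite ?permK ?permKV.
Qed.

(** [A] is truncated to finitely many basis tuples carrying almost all of its norm, and by symmetry
    of [A] the truncation is a combination of forms [sprod v]. *)
Lemma pow_sum_dense n (A : mform H n) e : HSform H n A -> 0 < e ->
  exists s, (hs_sqnorm (fun v => (A v - pow_sum (n:=n) s v)%R) <= e%:E)%E.
Proof.
move=> [_ As _ Afin] e0.
have [s0 [us0 s0T s0tail]] := esum_tail (fun v => sqre_ge0 (A v)) Afin e0.
(* Closing the list under permutations makes the truncation to it symmetric, as every combination of
   [sprod v] must be. *)
pose s1 := undup [seq v \o (s : 'S_n) | v <- s0, s <- enum 'S_n].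
have s1P w : reflect (exists v (s : 'S_n), v \in s0 /\ w = v \o s) (w \in s1).
  rewrite mem_undup; apply: (iffP allpairsP) => [[[v s] /= [vs _ ->]]|[v [s [vs ->]]]].
    by exists v, s.
  by exists (v, s); split; rewrite //= mem_enum.
have s1T w : w \in s1 -> onb_tuples w.
  by move=> /s1P[v [s [/s0T vT ->]]] j; exact: vT.
have s1perm w (s : 'S_n) : (w \o s \in s1) = (w \in s1).
  apply/s1P/s1P => -[v [t [vs wv]]]; last first.
    by exists v, (s * t)%g; split => //; rewrite wv; apply/funext => j /=; rewrite permM.
  exists v, (s^-1 * t)%g; split => //; apply/funext => j /=.
  by have := congr1 (@^~ ((s^-1)%g j)) wv; rewrite /= permKV permM.
have [t tP] := pow_sum_big s1 (fun v => A v / n`!%:R) (fun v => sprod_pow_sum v).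
exists t; rewrite /hs_sqnorm.
(* After exchanging the sums, each permutation contributes A w / n! or 0 according to whether [w] is
   in [s1]; the n! permutations restore [A w], whatever repetitions [w] has. *)
have tE w : onb_tuples w -> pow_sum t w = if w \in s1 then A w else 0.
  move=> Ew; rewrite -tP.
  rewrite (eq_big_seq (fun v => \sum_(s : 'S_n) A v / n`!%:R * (v == w \o (s^-1)%g)%:R)).
    rewrite exchange_big/=.
    rewrite (eq_bigr (fun=> if w \in s1 then A w / n`!%:R else 0)) => [|s _].
      rewrite sumr_const card_Sn; case: ifP => _; rewrite ?mul0rn//.
      by rewrite -[LHS]mulr_natr mulfVK// pnatr_eq0 -lt0n fact_gt0.
    rewrite -(s1perm w (s^-1)%g); case: ifPn => ws.
      rewrite (bigD1_seq (w \o (s^-1)%g)) ?undup_uniq//= eqxx mulr1 As.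
      by rewrite big1 ?addr0// => v /negbTE ->; rewrite mulr0.
    rewrite big1_seq// => v /= vs.
    by rewrite (_ : _ == _ = false) ?mulr0//; apply: contraNF ws => /eqP <-.
  move=> v vs; rewrite sprod_onb//; last exact: s1T.
  by rewrite big_distrr/=; apply: eq_bigr => s _; rewrite comp_perm_eq.
apply: (@le_trans _ _ (\esum_(v in onb_tuples (n:=n) `&` ~` [set` s1]) (A v ^+ 2)%:E)%E).
  rewrite [leRHS]esum_mkcondr; apply: le_esum => v Ev.
  rewrite (tE _ Ev) in_setC; case: ifPn => vs.
    by rewrite subrr expr0n/=; case: ifP => // _; exact: sqre_ge0.
  by rewrite subr0 mem_setE vs.
apply: s0tail => v [Ev /= /negP vs]; split => //; apply: contra vs => vs.
by apply/s1P; exists v, 1%g; split => //; apply/funext => j /=; rewrite perm1.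
Qed.

Lemma pow_sum_approx n (D : set H) (s : seq (R * H)) e :
  (forall h r, 0 < r -> exists2 f, D f & `|h - f| < r) -> 0 < e ->
  exists2 t : seq (R * H), {in t, forall p, D p.2} &
    (hs_sqnorm (fun v => (pow_sum (n:=n) s v - pow_sum (n:=n) t v)%R) <= e%:E)%E.
Proof.
move=> Ddense; elim: s e => [|[c h] s IH] e e0.
  exists [::] => //; rewrite /hs_sqnorm esum1 ?lee_fin ?(ltW e0)// => v _.
  by rewrite subrr expr0n.
have e4 : 0 < e / 4 by rewrite divr_gt0.
have [t tD tE] := IH _ e4.
pose M := (`|h| + 1) ^+ 2.
have [C C0 CP] := hs_sqnorm_powB H n (sqr_ge0 (`|h| + 1)).
(* The head costs at most 2 c^2 C |h - f|^2 <= K r <= e / 2 and the tail 2 (e / 4). The bound r <= 1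
   keeps |f| below |h| + 1, where [C] is valid, and gives |h - f|^2 <= r; the 1 in [K] makes it
   positive. *)
pose K := 2 * c ^+ 2 * C + 1.
have K0 : 0 < K by rewrite ltr_wpDl// mulr_ge0// mulr_ge0// sqr_ge0.
pose r := Num.min 1 (e / 2 / K).
have r0 : 0 < r by rewrite lt_min ltr01/= !divr_gt0.
have [f Df hf] := Ddense h r r0.
exists ((c, f) :: t) => [p|].
  by rewrite inE => /predU1P[->//|/tD].
rewrite /pow_sum; under eq_fun do rewrite !big_cons/=.
have -> : (fun v : 'I_n -> H =>
   c * form_pow h v + \sum_(p <- s) p.1 * form_pow p.2 v -
   (c * form_pow f v + \sum_(p <- t) p.1 * form_pow p.2 v)) =
  (fun v => c * (fun v => form_pow h v - form_pow f v) v +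
    (fun v => pow_sum s v - pow_sum t v) v).
  by apply/funext => v; rewrite /pow_sum; ring.
apply: le_trans (hs_sqnorm_lin _ _ _) _.
have r1 : r <= 1 by rewrite ge_min lexx.
have fM : `|f| ^+ 2 <= (`|h| + 1) ^+ 2.
  rewrite lerXn2r ?nnegrE ?addr_ge0//.
  have -> : f = h - (h - f) by rewrite opprB addrC subrK.
  by apply: le_trans (ler_normB _ _) _; rewrite lerD2l (le_trans (ltW hf)).
have hM : `|h| ^+ 2 <= (`|h| + 1) ^+ 2 by rewrite lerXn2r ?nnegrE ?addr_ge0// lerDl.
have c2 : 0 <= 2 * c ^+ 2 by rewrite mulr_ge0// sqr_ge0.
apply: (@le_trans _ _ ((2 * c ^+ 2)%:E * (C * `|h - f| ^+ 2)%:E + 2%:E * (e / 4)%:E)%E).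
  by apply: leeD; apply: lee_wpmul2l; rewrite ?lee_fin//; exact: CP.
rewrite -!EFinM -EFinD lee_fin.
have d2 : `|h - f| ^+ 2 <= r.
  rewrite expr2; apply: le_trans (_ : r * 1 <= r); last by rewrite mulr1.
  by apply: ler_pM => //; [exact: ltW|apply: le_trans r1; exact: ltW].
have : 2 * c ^+ 2 * (C * `|h - f| ^+ 2) <= e / 2.
  rewrite mulrA; apply: (@le_trans _ _ (K * r)).
    by apply: ler_pM => //; [exact: mulr_ge0|rewrite /K lerDl].
  by rewrite mulrC -ler_pdivlMr// ge_min lexx orbT.
by lra.
Qed.

Lemma pow_sum_dense_in n (D : set H) (A : mform H n) e :
  (forall h r, 0 < r -> exists2 f, D f & `|h - f| < r) -> HSform H n A -> 0 < e ->
  exists2 t : seq (R * H), {in t, forall p, D p.2} &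
    (hs_sqnorm (fun v => (A v - pow_sum (n:=n) t v)%R) <= e%:E)%E.
Proof.
move=> Ddense HA e0.
have e4 : 0 < e / 4 by rewrite divr_gt0.
have [s As] := pow_sum_dense HA e4.
have [t tD st] := pow_sum_approx n s Ddense e4.
exists t => //.
have -> : (fun v => A v - pow_sum t v) =
  (fun v => 1 * (A v - pow_sum s v) + (pow_sum s v - pow_sum t v)).
  by apply/funext => v; rewrite mul1r addrA subrK.
apply: le_trans (hs_sqnorm_lin _ _ _) _.
apply: (@le_trans _ _ ((2 * 1 ^+ 2)%:E * (e / 4)%:E + 2%:E * (e / 4)%:E)%E).
  by apply: leeD; apply: lee_wpmul2l; rewrite ?lee_fin// expr1n mulr1.
by rewrite -!EFinM -EFinD lee_fin expr1n; lra.
Qed.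

End polarization.

(** * Hermite polynomials *)

Section scaled_hermite.
Context (R : realType).
Implicit Types (s t a : R).

(* Hermite polynomials of variance [s]: [hermite n] is the case [s = 1], and
   [s = r ^+ 2] is the rescaling by [r]. *)
Fixpoint hermite_poly s n : {poly R} :=
  if n is m.+1 then 'X * hermite_poly s m - s *: (hermite_poly s m)^`() else 1.

(** The Appell property. It yields both the three-term recurrence and all higher derivatives, hence
    the Taylor expansion. *)
Lemma deriv_hermite_poly s n :
  (hermite_poly s n)^`() = n%:R *: hermite_poly s n.-1.
Proof.
elim: n => [|n IH]; first by rewrite scale0r /= -[1]/(1%:P) derivC.
rewrite [hermite_poly s n.+1]/= derivB derivM derivX mul1r derivZ.
case: n IH => [|n] IH; first by rewrite IH /= !scale0r derivC scaler0 subr0 mulr0 addr0 scale1r.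
rewrite IH /= derivZ -scalerAr -addrA !scalerA (mulrC s) -scalerA -scalerBr.
by rewrite -[n.+2]add1n natrD scalerDl scale1r.
Qed.

Lemma hermite_poly_rec s n t : (hermite_poly s n.+1).[t] =
  t * (hermite_poly s n).[t] - s * n%:R * (hermite_poly s n.-1).[t].
Proof. by rewrite /= deriv_hermite_poly !hornerE. Qed.

Lemma size_hermite_poly s n : (size (hermite_poly s n) <= n.+1)%N.
Proof.
elim: n => [|n IH] /=; first by rewrite size_poly1.
rewrite (leq_trans (size_polyD _ _))// geq_max; apply/andP; split.
  by rewrite (leq_trans (size_polyMleq _ _))// size_polyX.
rewrite size_polyN (leq_trans (size_scale_leq _ _))//.
rewrite (leq_trans (size_poly _ _))// (leq_trans (leq_pred _))//.
exact: leqW.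
Qed.

Lemma derivn_hermite_poly s n m : (m <= n)%N ->
  (hermite_poly s n)^`(m) = (n ^_ m)%:R *: hermite_poly s (n - m).
Proof.
elim: m => [_|m IH mn]; first by rewrite derivn0 ffactn0 scale1r subn0.
rewrite derivnS IH ?(ltnW mn)// derivZ deriv_hermite_poly scalerA -natrM -ffactnSr.
by rewrite subnS.
Qed.

(** Taylor's formula: the derivative of order m is the falling factorial of [n] times the polynomial
    of order n - m, and division by m! leaves the binomial coefficient. *)
Lemma hermite_polyD s n t a : (hermite_poly s n).[t + a] =
  \sum_(m < n.+1) 'C(n, m)%:R * ((hermite_poly s (n - m)).[t] * a ^+ m).
Proof.
rewrite (@nderiv_taylor_wide _ n.+1)//; last 2 first.
- exact: mulrC.
- exact: size_hermite_poly.
apply: eq_bigr => m _; rewrite mulrA; congr (_ * _).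
have mn : (m <= n)%N by rewrite -ltnS.
have /(congr1 (fun p => p.[t])) := nderivn_def m (hermite_poly s n).
rewrite derivn_hermite_poly// hornerZ hornerMn -bin_ffact natrM.
rewrite -[RHS]mulr_natr mulrAC => h; apply/esym; apply: mulIf h.
by rewrite pnatr_eq0 -lt0n fact_gt0.
Qed.

Lemma hermite_poly_scale r n t : r != 0 ->
  (hermite_poly (r ^+ 2) n).[t] = r ^+ n * (hermite_poly 1 n).[t / r].
Proof.
(* Two consecutive orders are carried along because the recurrence looks back two steps. *)
move=> r0; suff : (hermite_poly (r ^+ 2) n).[t] = r ^+ n * (hermite_poly 1 n).[t / r] /\
   (hermite_poly (r ^+ 2) n.+1).[t] = r ^+ n.+1 * (hermite_poly 1 n.+1).[t / r] by case.
elim: n => [|n [IH1 IH2]].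
  by rewrite !hermite_poly_rec /= !hornerE; split => //; field.
split => //; rewrite hermite_poly_rec [in RHS]hermite_poly_rec IH2 /= IH1.
by rewrite !exprS; field.
Qed.

(** Since g' = - s g, differentiating a polynomial times the Gaussian [g] reproduces, up to sign,
    the recurrence defining [hermite_poly]. *)
Lemma hermite_polyE n t : hermite n t = (hermite_poly 1 n).[t].
Proof.
pose g := fun s : R => expR (- (s ^+ 2 / 2)).
have dg s : is_derive s 1 g (- s * g s).
  have dq : is_derive s 1 (fun s : R => - (s ^+ 2 / 2)) (- s).
    have -> : (fun s : R => - (s ^+ 2 / 2)) = horner (- ((2^-1)%:P * 'X^2)).
      by apply/funext => u; rewrite hornerN hornerM hornerC hornerXn mulrC.
    apply: is_derive_eq; rewrite derivN derivM derivC mul0r add0r derivXn/= !hornerE.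
    by field.
  have := @is_derive1_comp _ expR (fun s : R => - (s ^+ 2 / 2)) s _ _ (is_derive_expR _) dq.
  by move=> h; apply: is_derive_eq h _; rewrite mulrC.
have E : derive1n n g = fun s => (-1) ^+ n * (hermite_poly 1 n).[s] * g s.
  elim: n => [|n IH].
    by apply/funext => s; rewrite derive1n0 [hermite_poly 1 0]/= hornerC expr0 !mul1r.
  apply/funext => s; rewrite derive1nS IH derive1E.
  have -> : (fun s0 => (-1) ^+ n * (hermite_poly 1 n).[s0] * g s0) =
     horner ((-1) ^+ n *: hermite_poly 1 n) * g.
     by apply/funext => u; rewrite fctE hornerZ.
  have h := is_deriveM (is_derive_poly ((-1) ^+ n *: hermite_poly 1 n) s) (dg s).
  have scaleE (a b : R) : a *: (b : R^o) = a * b by [].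
  rewrite derive_val !scaleE derivZ !hornerZ exprS.
  rewrite [hermite_poly 1 n.+1]/= hornerD hornerN hornerM hornerX hornerZ.
  by ring.
rewrite /hermite E.
have -> : (-1) ^+ n * expR (t ^+ 2 / 2) * ((-1) ^+ n * (hermite_poly 1 n).[t] * g t) =
  ((-1) ^+ n * (-1) ^+ n) * (expR (t ^+ 2 / 2) * g t) * (hermite_poly 1 n).[t] by ring.
by rewrite -expr2 sqrr_sign -expRD subrr expR0 !mul1r.
Qed.

End scaled_hermite.

(** * Sums over countable sets and integration *)

(** The enumeration may have gaps: [c j] is the element sent to [j] by an injection into the
    naturals, if any, and [None] contributes 0. Finite and empty sets are covered too. *)
Lemma esum_nneseries (R : realType) (T : choiceType) (S : set T) : countable S ->
  exists2 c : nat -> option T, (forall j v, c j = Some v -> S v) &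
  forall a : T -> \bar R, (forall v, (0 <= a v)%E) ->
    (\esum_(v in S) a v = \sum_(0 <= j <oo) oapp a 0 (c j))%E.
Proof.
move=> /countable_injP[f finj].
pose c j := if pselect (exists v, S v /\ f v = j) is left h then Some (sval (cid h)) else None.
have cf v : S v -> c (f v) = Some v.
  move=> Sv; rewrite /c; case: pselect => [h|[]]; last by exists v.
  case: cid => w [Sw fw] /=; congr Some; apply: finj; rewrite ?inE//.
exists c => [j v|a a0].
  by rewrite /c; case: pselect => // h [<-]; case: cid => ? [].
rewrite nneseries_esumT; last by move=> j; case: (c j) => //=.
transitivity (\esum_(j in f @` S) (oapp a 0 (c j)))%E.
  rewrite (reindex_esum S (f @` S) f).
    by apply: eq_esum => v Sv; rewrite cf.
  by split => // v Sv; exists v.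
rewrite esum_mkcond; apply: eq_esum => j _; case: ifPn => // /negP jS.
rewrite /c; case: pselect => // -[v [Sv fv]]; exfalso; apply: jS; rewrite inE.
by exists v.
Qed.

Section measure_facts.
Context d (X : measurableType d) (R : realType).
Context (mu : {measure set X -> \bar R}).
Local Open Scope ereal_scope.

Section esum_integral.
Context (T : choiceType) (S : set T) (F : T -> X -> \bar R).
Hypothesis (cS : countable S).
Hypothesis (mF : forall v, S v -> measurable_fun setT (F v)).
Hypothesis (F0 : forall v x, 0 <= F v x).

Lemma measurable_esum : measurable_fun setT (fun x => \esum_(v in S) F v x).
Proof.
have [c cS' cE] := esum_nneseries R cS.
under eq_fun do rewrite cE//.
apply: (eq_measurable_fun (fun x => \sum_(0 <= j <oo | j \in xpredT) oapp (F^~ x) 0 (c j))).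
  by [].
apply: ge0_emeasurable_sum => [j x _ _|j _].
  by case: (c j) => //= v.
by case E: (c j) => [v|] /=; [exact/mF/(cS' j)|exact: measurable_cst].
Qed.

Lemma integral_esum :
  \int[mu]_x (\esum_(v in S) F v x) = \esum_(v in S) \int[mu]_x (F v x).
Proof.
have [c cS' cE] := esum_nneseries R cS.
under eq_integral do rewrite cE//.
rewrite integral_nneseries//.
- rewrite cE; last by move=> v; apply: integral_ge0.
  apply: eq_eseriesr => j _; case: (c j) => [v|] //=.
  by rewrite integral0.
- by move=> j; case E: (c j) => [v|] /=; [exact/mF/(cS' j)|exact: measurable_cst].
- by move=> j x _; case: (c j) => //= v.
Qed.

End esum_integral.

(** A Borel-Cantelli argument: by Tonelli the sum of the [phi j] has integral at most [c], so it is
    finite almost everywhere and its tails become small. *)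
Lemma ae_small (phi : nat -> X -> \bar R) (c : R) :
  (forall j, measurable_fun setT (phi j)) -> (forall j x, 0 <= phi j x) ->
  (forall j, \int[mu]_x phi j x <= (c / (2 ^ j.+1)%:R)%:E) ->
  \forall x \ae mu, forall e : R, (0 < e)%R ->
    exists N, forall j, (N <= j)%N -> phi j x <= e%:E.
Proof.
move=> mphi phi0 phic.
have c0 : (0 <= c)%R.
  have := le_trans (integral_ge0 mu (fun x _ => phi0 0%N x)) (phic 0%N).
  by rewrite lee_fin pmulr_lge0// invr_gt0.
have cN : countable [set: nat] by exact: card_lexx.
have fin : \int[mu]_x (\esum_(j in [set: nat]) phi j x) < +oo.
  rewrite integral_esum//; apply: (@le_lt_trans _ _ c%:E); last exact: ltry.
  apply: le_trans (epsilon_trick0 xpredT c0).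
  rewrite nneseries_esumT; last by move=> j; rewrite lee_fin divr_ge0.
  by apply: le_esum => j _; exact: phic.
have mes : measurable_fun setT (fun x => \esum_(j in [set: nat]) phi j x).
  exact: measurable_esum.
have int : mu.-integrable setT (fun x => \esum_(j in [set: nat]) phi j x).
  apply/integrableP; split => //; under eq_integral do rewrite gee0_abs ?esum_ge0//.
  exact: fin.
have := integrable_ae measurableT int.
apply: filterS => x /(_ I) fx e e0.
have [|s [_ _ sP]] := esum_tail (phi0^~ x) _ e0 (S := setT).
  by rewrite -ge0_fin_numE// esum_ge0.
(* Past the largest index in [s], the singleton of [j] is itself a tail. *)
exists (\max_(i <- s) i).+1 => j sj.
apply: le_trans (sP [set j] _).
  by rewrite esum_set1.
move=> _ ->; split => //; apply/negP => js.
by move: sj; rewrite ltnNge => /negP; apply; exact: leq_bigmax_seq.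
Qed.

End measure_facts.

(** * Partial evaluation of forms *)

Section slices.
Context (R : realType) (H : hilbertType R).
Implicit Types (f g h x y : H).

Lemma onb_tuples_countable n : separable H -> countable (onb_tuples (H:=H) (n:=n)).
Proof.
move=> sepH; have cE := onb_countable sepH.
elim: n => [|n IH].
  apply: (@sub_countable _ _ _ [set (fun=> 0) : 'I_0 -> H]); last exact: countable1.
  by apply: subset_card_le => w _ /=; apply/funext => -[].
apply: (@sub_countable _ _ _ ((fun z => fcons z.1 z.2) @` (onb H `*` onb_tuples (H:=H) (n:=n)))).
  apply: subset_card_le => w Ew; exists (w ord0, w \o lift ord0); last by rewrite -fcons_eta.
  by split => [|j]; exact: Ew.
apply: sub_countable (card_image_le _ _) _.
exact: countableX.
Qed.

Lemma form_scale n (A : mform H n) (c : 'I_n -> R) (v : 'I_n -> H) : multilinear A ->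
  A (fun j => c j *: v j) = (\prod_j c j) * A v.
Proof.
move=> Al; elim: n A c v Al => [|n IH] A c v Al.
  by rewrite big_ord0 mul1r; congr A; apply/funext => -[].
have Al0 x (w : 'I_n -> H) a : A (fcons (a *: x) w) = a * A (fcons x w).
  have h0 := Al (fcons 0 w) ord0 0 0 0; have h1 := Al (fcons 0 w) ord0 a x 0.
  move: h0 h1; rewrite -!fcons_upd0 scale0r !addr0 mul0r add0r => _ ->.
  have := Al (fcons 0 w) ord0 1 0 0; rewrite -!fcons_upd0 scaler0 addr0 mul1r => h.
  have -> : A (fcons 0 w) = 0 by apply: (addrI (A (fcons 0 w))); rewrite -h addr0.
  by rewrite addr0.
rewrite (fcons_eta (fun j => _)) Al0 big_ord_recl -mulrA; congr (_ * _).
rewrite [in RHS](fcons_eta v).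
apply: (IH (fun w => A (fcons (v ord0) w)) (c \o lift ord0) (v \o lift ord0)).
by move=> w i a x y; rewrite !fcons_updS Al.
Qed.

(** Rescaling by |h| + 1 rather than |h| reaches the unit ball without a case h = 0, and yields a
    positive factor by which one can divide. *)
Lemma form_diag_sqr_le n (A : mform H n) h : multilinear A -> bounded_form A ->
  ((A (diag h) ^+ 2)%:E <= (((`|h| + 1) ^+ n) ^+ 2)%:E * hs_sqnorm A)%E.
Proof.
move=> Al Ab; have h0 : 0 < `|h| + 1 by rewrite ltr_wpDl.
have -> : A (diag h) = (`|h| + 1) ^+ n * A (diag ((`|h| + 1)^-1 *: h)).
  have := form_scale (fun=> `|h| + 1) (diag ((`|h| + 1)^-1 *: h)) Al.
  rewrite prodr_const card_ord => <-; congr (A _); apply/funext => j.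
  by rewrite /diag scalerA divff ?scale1r// gt_eqF.
rewrite exprMn EFinM; apply: lee_wpmul2l; first exact: sqre_ge0.
apply: form_sqr_le => // j; rewrite /diag normrZ normfV (gtr0_norm h0).
by rewrite ler_pdivrMl// mulr1 lerDl.
Qed.

Lemma cat_vec_lshift k m n (e : (k + m)%N = n) (u : 'I_k -> H) w j :
  cat_vec e u w (cast_ord e (lshift m j)) = u j.
Proof.
by case: n / e; rewrite /cat_vec !cast_ord_id; case: fintype.split_ordP => i /eqP;
  rewrite ?eq_lshift ?eq_lrshift// => /eqP ->.
Qed.

Lemma cat_vec_rshift k m n (e : (k + m)%N = n) (u : 'I_k -> H) w j :
  cat_vec e u w (cast_ord e (rshift k j)) = w j.
Proof.
by case: n / e; rewrite /cat_vec !cast_ord_id; case: fintype.split_ordP => i /eqP;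
  rewrite ?eq_rshift ?eq_rlshift// => /eqP ->.
Qed.

Lemma cat_ordP k m n (e : (k + m)%N = n) (P : 'I_n -> Prop) :
  (forall j, P (cast_ord e (lshift m j))) -> (forall j, P (cast_ord e (rshift k j))) ->
  forall i, P i.
Proof.
case: n / e P => P Pl Pr i; rewrite -[i](cast_ord_id erefl).
by case: (fintype.split_ordP i) => j ->.
Qed.

Lemma cat_vec_updl k m n (e : (k + m)%N = n) (u : 'I_k -> H) w i x :
  cat_vec e [eta u with i |-> x] w =
  [eta cat_vec e u w with cast_ord e (lshift m i) |-> x].
Proof.
apply/funext => /=; apply: (cat_ordP (e := e)) => j.
  by rewrite cat_vec_lshift /= cat_vec_lshift (inj_eq (@cast_ord_inj _ _ _)) eq_lshift.
by rewrite cat_vec_rshift /= cat_vec_rshift (inj_eq (@cast_ord_inj _ _ _)) eq_rlshift.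
Qed.

(** Block permutations. Taking [s] or [t] to be the identity gives the symmetry of a sliced form in
    either group of variables. *)
Lemma cat_vec_perm k m n (e : (k + m)%N = n) (s : 'S_k) (t : 'S_m) :
  exists p : 'S_n, forall (u : 'I_k -> H) w,
    cat_vec e (u \o s) (w \o t) = cat_vec e u w \o p.
Proof.
case: n / e.
pose q (j : 'I_(k + m)) := match fintype.split j with
  inl a => lshift m (s a) | inr b => rshift k (t b) end.
have ql a : q (lshift m a) = lshift m (s a).
  by rewrite /q; case: fintype.split_ordP => i /eqP; rewrite ?eq_lshift ?eq_lrshift// => /eqP ->.
have qr a : q (rshift k a) = rshift k (t a).
  by rewrite /q; case: fintype.split_ordP => i /eqP; rewrite ?eq_rshift ?eq_rlshift// => /eqP ->.
have qinj : injective q.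
  move=> i j; case: (fintype.split_ordP i) => a ->; case: (fintype.split_ordP j) => b ->;
  rewrite ?ql ?qr => /eqP; rewrite ?eq_lshift ?eq_rshift ?eq_lrshift ?eq_rlshift//.
  - by rewrite (inj_eq perm_inj) => /eqP ->.
  - by rewrite (inj_eq perm_inj) => /eqP ->.
exists (perm qinj) => u w; apply/funext => i /=; rewrite permE.
rewrite -[q i](cast_ord_id erefl) -[in LHS](cast_ord_id erefl i).
case: (fintype.split_ordP i) => a ->; rewrite ?ql ?qr.
  by rewrite !cat_vec_lshift.
by rewrite !cat_vec_rshift.
Qed.

Lemma esum_cat k m n (e : (k + m)%N = n) (a : ('I_n -> H) -> \bar R) :
  (forall v, (0 <= a v)%E) ->
  (\esum_(v in onb_tuples (n:=n)) a v =
   \esum_(w in onb_tuples (n:=m)) \esum_(u in onb_tuples (n:=k)) a (cat_vec e u w))%E.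
Proof.
move=> a0; apply: (esum_pair (c := fun w u => cat_vec e u w)) => //.
- move=> w u Ew Eu; apply: (cat_ordP (e := e)) => j.
    by rewrite cat_vec_lshift; exact: Eu.
  by rewrite cat_vec_rshift; exact: Ew.
- move=> w u w' u' E; split; apply/funext => j.
    by have := congr1 (@^~ (cast_ord e (rshift k j))) E; rewrite !cat_vec_rshift.
  by have := congr1 (@^~ (cast_ord e (lshift m j))) E; rewrite !cat_vec_lshift.
- move=> v Ev; exists (fun j => v (cast_ord e (rshift k j))), (fun j => v (cast_ord e (lshift m j))).
  split => [j|j|]; [exact: Ev|exact: Ev|].
  apply/funext; apply: (cat_ordP (e := e)) => j.
    by rewrite cat_vec_lshift.
  by rewrite cat_vec_rshift.
Qed.

Lemma hs_sqnorm_slices k m n (e : (k + m)%N = n) (A : mform H n) :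
  hs_sqnorm A = (\esum_(w in onb_tuples (n:=m)) hs_sqnorm (fun u => A (cat_vec e u w)))%E.
Proof. by rewrite {1}/hs_sqnorm (esum_cat e)// => v; exact: sqre_ge0. Qed.

Lemma curry_form_symmetric k m n (e : (k + m)%N = n) (A : mform H n) u :
  Defs.symmetric_form A -> Defs.symmetric_form (curry_form e A u).
Proof.
move=> As w t; have [p pE] := cat_vec_perm e 1%g t; rewrite /curry_form.
have -> : cat_vec e u (w \o t) = cat_vec e u w \o p.
  by rewrite -pE; congr cat_vec; apply/funext => j /=; rewrite perm1.
exact: As.
Qed.

Lemma prod_cat_vec k m n (e : (k + m)%N = n) (F : H -> R) (u : 'I_k -> H) w :
  \prod_(j < n) F (cat_vec e u w j) = (\prod_(j < k) F (u j)) * \prod_(j < m) F (w j).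
Proof.
case: n / e; rewrite big_split_ord/=; congr (_ * _); apply: eq_bigr => j _.
  by rewrite -[lshift _ _](cast_ord_id erefl) cat_vec_lshift.
by rewrite -[rshift _ _](cast_ord_id erefl) cat_vec_rshift.
Qed.

(** The slice at a basis tuple has finite norm because its squared norm is a single term of the sum
    in [hs_sqnorm_slices]. *)
Lemma HSform_slice k m n (e : (k + m)%N = n) (A : mform H n) w :
  HSform H n A -> onb_tuples w -> HSform H k (fun u => A (cat_vec e u w)).
Proof.
move=> [Al As [C AC] Af] Ew; split.
- by move=> u i a x y; rewrite !cat_vec_updl Al.
- move=> u s; have [p pE] := cat_vec_perm e s 1%g.
  have -> : cat_vec e (u \o s) w = cat_vec e u w \o p.
    by rewrite -pE; congr cat_vec; apply/funext => j /=; rewrite perm1.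
  exact: As.
- exists (C * \prod_(j < m) `|w j|) => u; apply: le_trans (AC _) _.
  rewrite -mulrA mulrC -(mulrC C) le_eqVlt; apply/orP; left; apply/eqP; congr (_ * _).
  by rewrite (prod_cat_vec e Num.norm) mulrC.
- apply: le_lt_trans Af; rewrite (hs_sqnorm_slices e A).
  apply: (@esum_ge1 _ _ _ (fun w => hs_sqnorm (fun u => A (cat_vec e u w)))) Ew.
Qed.

Lemma cat_vec_pow k m n (e : (k + m)%N = n) f (u : 'I_k -> H) w :
  form_pow (n:=n) f (cat_vec e u w) = form_pow (n:=k) f u * form_pow (n:=m) f w.
Proof. exact: (prod_cat_vec e (hdot^~ f)). Qed.

(** [B] takes the value [B v] at every rearrangement of [v], so the products are [B v] times the
    number [N w] of permutations leading to [w], and these numbers add up to n!. Thus [sprod v]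
    serves as a test form that reads off the value at [v]. *)
Lemma hs_dot_sprod n (B : mform H n) v : Defs.symmetric_form B -> onb_tuples v ->
  hs_dot B (sprod v) = n`!%:R * B v.
Proof.
move=> Bs Ev; rewrite /hs_dot.
pose N (w : 'I_n -> H) := \sum_(s : 'S_n) (w == v \o s)%:R : R.
have N0 w : 0 <= N w by apply: sumr_ge0.
have EN w : onb_tuples w -> B w * sprod v w = B v * N w.
  move=> Ew; rewrite sprod_onb// !big_distrr/=; apply: eq_bigr => s _.
  by case: eqP => [->|_]; rewrite ?Bs// !mulr0.
have sN : (\esum_(w in onb_tuples (n:=n)) (N w)%:E = n`!%:R%:E)%E.
  under eq_esum do rewrite -sumEFin.
  rewrite esum_sum; last by move=> w s _ _; rewrite lee_fin.
  rewrite (eq_bigr (fun=> 1%E)); last first.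
    move=> s _; rewrite esum_mkcond.
    rewrite -[RHS](@esum_set1 R _ (v \o s) (fun=> 1%E))// [RHS]esum_mkcond.
    apply: eq_esum => w _; case: eqP => [->|wv]; last by rewrite [in RHS]memNset//; case: ifP.
    by rewrite !mem_set// => j; exact: Ev.
  by rewrite sumEFin sumr_const card_Sn.
have Z : esum (onb_tuples (H:=H) (n:=n)) (fun=> 0%E) = 0%E :> \bar R by apply: esum1.
(* All products have the sign of [B v], so one of the two nonnegative sums in [hs_dot] vanishes. *)
have [Bv|/ltW Bv] := leP 0 (B v).
  rewrite (eq_esum (b := fun w => ((B v)%:E * (N w)%:E)%E)); last first.
    move=> w Ew; rewrite funeposE EN// -EFinM; apply/max_idPl.
    by rewrite lee_fin mulr_ge0.
  rewrite esumZl//.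
  rewrite sN (eq_esum (b := fun=> 0%E)); last first.
    move=> w Ew; rewrite funenegE EN// -EFinN; apply/max_idPr.
    by rewrite lee_fin oppr_le0 mulr_ge0.
  by rewrite Z subr0 -EFinM /= mulrC.
rewrite (eq_esum (b := fun=> 0%E)); last first.
  move=> w Ew; rewrite funeposE EN//; apply/max_idPr.
  by rewrite lee_fin mulr_le0_ge0.
rewrite Z (eq_esum (b := fun w => ((- B v)%:E * (N w)%:E)%E)); last first.
  move=> w Ew; rewrite funenegE EN// -EFinN -EFinM mulNr; apply/max_idPl.
  by rewrite lee_fin -mulNr mulr_ge0// oppr_ge0.
rewrite esumZl ?oppr_ge0//.
by rewrite sN -EFinM /= sub0r mulNr opprK mulrC.
Qed.

End slices.

(** * Multiple integrals *)

Section ae_borel.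
Context (R : realType) (X : completeNormedModType R).
Implicit Types (mu nu : probability (borel X) R) (P Q : X -> Prop).

(* [filterS] does not see the carrier [borel X] behind predicates on [X]. *)
Lemma ae_imp mu P Q : (forall x, P x -> Q x) ->
  (\forall x \ae mu, P x) -> \forall x \ae mu, Q x.
Proof. exact: (@filterS _ _ (ae_filter_ringOfSetsType mu)). Qed.

Lemma ae_imp2 mu P1 P2 Q : (forall x, P1 x -> P2 x -> Q x) ->
  (\forall x \ae mu, P1 x) -> (\forall x \ae mu, P2 x) -> \forall x \ae mu, Q x.
Proof. exact: (@filterS2 _ _ (ae_filter_ringOfSetsType mu)). Qed.

Lemma ae_and mu P Q : (\forall x \ae mu, P x) -> (\forall x \ae mu, Q x) ->
  \forall x \ae mu, P x /\ Q x.
Proof. exact: ae_imp2. Qed.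

Lemma ae_all mu P : (forall x, P x) -> \forall x \ae mu, P x.
Proof. exact: (@aeW _ _ _ mu). Qed.

Lemma ae_countable mu (T : choiceType) (S : set T) (P : T -> X -> Prop) : countable S ->
  (forall v, S v -> \forall x \ae mu, P v x) ->
  \forall x \ae mu, forall v, S v -> P v x.
Proof.
move=> /countable_injP[f finj] SP.
have : \forall x \ae mu, forall j v, S v /\ f v = j -> P v x.
  apply: (@ae_foralln _ _ _ mu (fun j (x : borel X) => forall v, S v /\ f v = j -> P v x)) => j.
  have [[v [Sv fv]]|nv] := pselect (exists v, S v /\ f v = j).
    apply: ae_imp (SP v Sv) => x Pvx w [Sw fw].
    by have -> : w = v by apply: finj; rewrite ?inE// fw fv.
  by apply: ae_all => x v vP; exfalso; apply: nv; exists v.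
by apply: ae_imp => x Px v Sv; exact: (Px (f v)).
Qed.

Lemma ae_ord mu n (P : 'I_n -> X -> Prop) : (forall i, \forall x \ae mu, P i x) ->
  \forall x \ae mu, forall i, P i x.
Proof.
move=> iP; have : \forall x \ae mu, forall i, [set: 'I_n] i -> P i x.
  by apply: ae_countable => //; exact: countableP.
by apply: ae_imp => x Px i; exact: Px.
Qed.

Lemma ae_nat mu (P : nat -> X -> Prop) : (forall i, \forall x \ae mu, P i x) ->
  \forall x \ae mu, forall i, P i x.
Proof. exact: (@ae_foralln _ _ _ mu). Qed.

Lemma ae_dominated mu nu P : nu `<< mu ->
  (\forall x \ae mu, P x) -> \forall x \ae nu, P x.
Proof.
move=> /null_content_dominatesP numu [N [mN N0 PN]]; exists N; split => //.
exact: numu.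
Qed.

Lemma ae_full mu (X0 : set (borel X)) : measurable X0 -> mu X0 = 1%E ->
  \forall x \ae mu, X0 x.
Proof.
move=> mX0 X01; exists (~` X0); split => //; first exact: measurableC.
by rewrite probability_setC// X01 subee.
Qed.

(** The exceptional set is the part of [X0] that [T] sends into a [mu]-null set; [T] is controlled
    on [X0] only, hence the implication. *)
Lemma ae_pullback mu nu (X0 : set (borel X)) (T : borel X -> borel X) P :
  measurable X0 -> measurable_fun X0 T ->
  (forall B : set (borel X), measurable B -> nu (X0 `&` T @^-1` B) = mu B) ->
  (\forall x \ae mu, P x) -> \forall x \ae nu, X0 x -> P (T x).
Proof.
move=> mX0 mT nuT [N [mN N0 PN]]; exists (X0 `&` T @^-1` N); split.
- exact: mT.
- by rewrite nuT.
- by move=> x /= /not_implyP[X0x PTx]; split => //; exact: PN.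
Qed.

End ae_borel.

Section multiple_integral_facts.
Context (R : realType) (X : completeNormedModType R) (H : hilbertType R).
Context (iota : {linear H -> X}) (mu : probability (borel X) R).
Context (n : nat) (I : mform H n -> X -> R).
Hypothesis IP : is_multiple_integral iota mu I.

Lemma measurable_multiple_integral A : HSform H n A ->
  measurable_fun setT (I A : borel X -> R).
Proof.
by case: IP => Lf _ _ _ /Lf /sub_Lfun_mfun; rewrite inE.
Qed.

Lemma multiple_integral_sqr_le : exists2 K, 0 <= K & forall A, HSform H n A ->
  (\int[mu]_x ((I A x) ^+ 2)%:E <= K%:E * hs_sqnorm A)%E.
Proof.
case: IP => _ _ [C CP] _; exists (C ^+ 2); first exact: sqr_ge0.
move=> A HA; have [_ _ _ Afin] := HA.
have hsfin : hs_sqnorm A \is a fin_num by rewrite ge0_fin_numE// hs_sqnorm_ge0.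
have -> : (\int[mu]_x ((I A x) ^+ 2)%:E = 'N[mu]_2%:E [EFin \o (I A : borel X -> R)] `^ 2)%E.
  rewrite poweR_Lnorm//; apply: eq_integral => x _ /=.
  transitivity ((`|I A x| `^ 2%:R)%:E); last by rewrite -poweR_EFin.
  by rewrite powR_mulrn// real_normK// num_real.
have := CP A HA; have := Lnorm_ge0 mu 2%:E (EFin \o (I A : borel X -> R)).
case: ('N[mu]_2%:E [_])%E => // r; rewrite !lee_fin => r0 rC.
rewrite poweR_EFin [r `^ _](@powR_mulrn _ r 2)// -(fineK hsfin) -EFinM lee_fin.
have -> : C ^+ 2 * fine (hs_sqnorm A) = (C * hs_norm A) ^+ 2.
  by rewrite exprMn sqr_sqrtr// fine_ge0// hs_sqnorm_ge0.
by rewrite ler_pXn2r// nnegrE// (le_trans r0).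
Qed.

Lemma multiple_integral_lin a A B : HSform H n A -> HSform H n B ->
  \forall x \ae mu, I (fun v => a * A v + B v) x = a * I A x + I B x.
Proof. by case: IP => _ + _ _; apply. Qed.

Lemma multiple_integral0 : \forall x \ae mu, I (fun=> 0) x = 0.
Proof.
have := multiple_integral_lin 1 (HSform0 H n) (HSform0 H n).
apply: ae_imp => x; under eq_fun do rewrite mulr0 addr0.
by rewrite mul1r => h; apply: (addrI (I (fun=> 0) x)); rewrite addr0 -h.
Qed.

Lemma multiple_integralZ a A : HSform H n A ->
  \forall x \ae mu, I (fun v => a * A v) x = a * I A x.
Proof.
move=> HA; have := multiple_integral_lin a HA (HSform0 H n).
apply: ae_imp2 multiple_integral0 => x I0.
by under eq_fun do rewrite addr0; rewrite I0 addr0.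
Qed.

Lemma multiple_integralB A B : HSform H n A -> HSform H n B ->
  \forall x \ae mu, I (fun v => A v - B v) x = I A x - I B x.
Proof.
move=> HA HB; have := multiple_integral_lin (-1) HB HA.
by apply: ae_imp => x; under eq_fun do rewrite mulN1r addrC; rewrite mulN1r addrC.
Qed.

End multiple_integral_facts.

Lemma multiple_integral_pow (R : realType) (X : completeNormedModType R)
    (H : hilbertType R) (iota : {linear H -> X}) (mu : probability (borel X) R)
    (Imu : forall n : nat, mform H n -> X -> R) (f : H) :
  (forall n : nat, is_multiple_integral iota mu (Imu n)) -> dual_vec iota f ->
  exists2 l : {linear X -> R}, riesz_rep iota l f & forall n,
    \forall x \ae mu, Imu n (form_pow f) x = (hermite_poly (`|f| ^+ 2) n).[l x].
Proof.
move=> ImuP [l lc lf].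
(* A zero vector cannot be normalized. The zero functional replaces [l]; order 0 is the empty
   product of Hermite polynomials, and in positive order both sides vanish. *)
have [f0|f0] := eqVneq f 0.
  exists (\0 : {linear X -> R}); first by move=> h; rewrite f0 hdot0r.
  case=> [|n].
    have [_ _ _ /(_ (form_pow (n:=0) f) 0%N (fun=> \0) (fun=> 0%N))] := ImuP 0%N.
    have fin : is_fin_form iota (form_pow (n:=0) f) (fun _ : 'I_0 => \0 : {linear X -> R}) (fun=> 0%N).
      exists (fun=> 0); split; [by case|by case|by rewrite big_ord0|exact: HSform_pow|].
      by move=> h; rewrite /form_pow !big_ord0.
    by move=> /(_ fin); apply: ae_imp => x ->; rewrite big_ord0 /= hornerC.
  have -> : form_pow (n:=n.+1) f = fun=> 0.
    by apply/funext => v; rewrite form_powS f0 hdot0r mul0r.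
  apply: ae_imp (multiple_integral0 (ImuP n.+1)) => x ->.
  by rewrite hermite_poly_rec f0 normr0 expr0n/= !mul0r subrr.
exists l => // n; pose r := `|f|; have r0 : r != 0 by rewrite normr_eq0.
(* The unit vector [g] alone is an orthonormal system, so the integral of its power is one Hermite
   polynomial; [hermite_poly_scale] returns to [f]. *)
pose g := r^-1 *: f.
have Llin : linear (fun x => r^-1 * l x).
  by move=> b x y; rewrite !linearP/= /GRing.scale/=; ring.
pose L : {linear X -> R} := HB.pack (fun x => r^-1 * l x)
  (GRing.isLinear.Build R X R _ _ Llin).
have fin : is_fin_form iota (form_pow (n:=n) g) (fun _ : 'I_1 => L) (fun=> n).
  exists (fun=> g); split.
  - move=> _; split.
      by move=> x; apply: cvgM; [exact: cvg_cst|exact: lc].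
    by move=> h; rewrite /L /= hdotZr lf.
  - move=> i j; rewrite !ord1 eqxx hdotZl hdotZr hdot_norm -/r expr2 mulrA.
    by rewrite mulrACA mulVf// mulr1.
  - by rewrite big_ord1.
  - exact: HSform_pow.
  - by move=> h; rewrite big_ord1 /form_pow (eq_bigr (fun=> hdot h g))// prodr_const card_ord.
have [_ _ _ /(_ _ _ _ _ fin)] := ImuP n.
have -> : form_pow (n:=n) f = fun v => r ^+ n * form_pow (n:=n) g v.
  apply/funext => v; have -> : r ^+ n = \prod_(j < n) r by rewrite prodr_const card_ord.
  rewrite /form_pow -big_split/=; apply: eq_bigr => j _.
  by rewrite hdotZr mulrA divff// mul1r.
apply: ae_imp2 (multiple_integralZ (ImuP n) (r ^+ n) (HSform_pow n g)) => x -> ->.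
rewrite big_ord1 hermite_polyE [RHS]hermite_poly_scale//.
by rewrite [l x / r]mulrC.
Qed.

(** * The change of variables formula *)

Section transport.
Context (R : realType) (X : completeNormedModType R) (H : hilbertType R).
Context (iota : {linear H -> X}) (mu nu : probability (borel X) R).
Context (iota_inj : injective iota) (iota_cont : continuous iota) (sepH : separable H).
Context (Imu : forall n : nat, mform H n -> X -> R).
Context (ImuP : forall n : nat, is_multiple_integral iota mu (@Imu n)).
Context (X0 : set (borel X)) (T : borel X -> borel X).
Context (X0_borel : measurable X0) (T_meas : measurable_fun X0 T).
Context (nu_T : forall B : set (borel X), measurable B ->
  nu (X0 `&` T @^-1` B) = mu B).
Context (T_shift : forall x : X, X0 x -> range iota ((T x : X) - x)).
Context (nu_mu : nu `<< mu).

Definition shift_vec (x : X) : H := cm_vec iota ((T x : X) - x).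

Lemma shift_vecP x : X0 x -> iota (shift_vec x) = (T x : X) - x.
Proof.
move=> /T_shift[h _ hx].
exact: (xgetPex (P := [set h | iota h = (T x : X) - x]) 0 (ex_intro _ h hx)).
Qed.

(* [K m] represents the integral of order [n - m] of [A], tested on tuples of
   basis vectors only. *)
Definition transport_formula n (A : mform H n)
    (K : forall m : 'I_n.+1, X -> mform H m) : Prop :=
  [/\ forall (m : 'I_n.+1) x, HSform H m (K m x),
      forall (m : 'I_n.+1) (w : 'I_m -> H), onb_tuples w -> \forall x \ae mu,
        K m x w = Imu (fun h => curry_form (subnK (leq_ord m)) A h w) x
    & \forall x \ae nu, X0 x -> Imu A (T x) =
        \sum_(m < n.+1) 'C(n, m)%:R * K m x (diag (shift_vec x))].

Lemma HSform_curry n (A : mform H n) (m : 'I_n.+1) w : HSform H n A -> onb_tuples w ->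
  HSform H (n - m) (fun h => curry_form (subnK (leq_ord m)) A h w).
Proof. exact: HSform_slice. Qed.

(** Slicing a power at [w] gives the power of order n - m times the number [form_pow f w], so the
    vector-valued integral is a Hermite polynomial in [l x] times the power of order m. *)
Lemma transport_pow n f : dual_vec iota f ->
  exists K, transport_formula (form_pow (n:=n) f) K.
Proof.
move=> /(multiple_integral_pow ImuP)[l lf lP].
exists (fun (m : 'I_n.+1) x (v : 'I_m -> H) =>
  (hermite_poly (`|f| ^+ 2) (n - m)).[l x] * form_pow (n:=m) f v); split.
- by move=> m x; apply: HSformZ; exact: HSform_pow.
- move=> m w Ew.
  have E : (fun h => curry_form (subnK (leq_ord m)) (form_pow (n:=n) f) h w) =
      (fun h => form_pow (n:=m) f w * form_pow (n:=n - m) f h).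
    by apply/funext => h; rewrite /curry_form cat_vec_pow mulrC.
  apply: ae_imp2 (lP (n - m)%N)
    (multiple_integralZ (ImuP (n - m)%N) (form_pow f w) (HSform_pow _ f)) => x lPx Zx.
  by rewrite E Zx lPx mulrC.
- apply: ae_imp (ae_pullback X0_borel T_meas nu_T (lP n)) => x h X0x.
  rewrite (h X0x).
  have -> : l (T x) = l x + hdot (shift_vec x) f.
    by rewrite -lf shift_vecP// -linearD/= addrC subrK.
  rewrite hermite_polyD; apply: eq_bigr => m _; rewrite /form_pow /diag.
  by rewrite prodr_const card_ord.
Qed.

Lemma transport_lin n a (A B : mform H n) K L : HSform H n A -> HSform H n B ->
  transport_formula A K -> transport_formula B L ->
  transport_formula (fun v => a * A v + B v) (fun (m : 'I_n.+1) x (v : 'I_m -> H) => a * K m x v + L m x v).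
Proof.
move=> HA HB [KH KI KT] [LH LI LT]; split.
- by move=> m x; exact: HSform_lin.
- move=> m w Ew.
  have hI := multiple_integral_lin (ImuP (n - m)%N) a (HSform_curry HA Ew) (HSform_curry HB Ew).
  apply: ae_imp2 hI (ae_and (KI m w Ew) (LI m w Ew)) => x + [Kx Lx].
  by rewrite Kx Lx => <-.
- have hI := ae_pullback X0_borel T_meas nu_T (multiple_integral_lin (ImuP n) a HA HB).
  apply: ae_imp2 hI (ae_and KT LT) => x hx [Kx Lx] X0x.
  rewrite hx// Kx// Lx// big_distrr/= -big_split/=; apply: eq_bigr => m _.
  by ring.
Qed.

Lemma transport_pow_sum n (t : seq (R * H)) : {in t, forall p, dual_vec iota p.2} ->
  exists K, transport_formula (pow_sum (n:=n) t) K.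
Proof.
elim: t => [_|[c f] t IH tD].
  have -> : pow_sum (n:=n) ([::] : seq (R * H)) = fun=> 0 by apply/funext => v; rewrite /pow_sum big_nil.
  exists (fun (m : 'I_n.+1) (_ : X) (_ : 'I_m -> H) => 0 : R); split.
  - by move=> m x; exact: HSform0.
  - by move=> m w Ew; apply: ae_imp (multiple_integral0 (ImuP (n - m)%N)) => x ->.
  - have := ae_pullback X0_borel T_meas nu_T (multiple_integral0 (ImuP n)).
    apply: ae_imp => x hx X0x; rewrite hx// big1// => m _; exact: mulr0.
have [K KP] : exists K, transport_formula (form_pow (n:=n) f) K.
  by apply: transport_pow; exact: (tD _ (mem_head _ _)).
have [L LP] : exists L, transport_formula (pow_sum (n:=n) t) L.
  by apply: IH => p pt; apply: tD; rewrite inE pt orbT.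
have -> : pow_sum (n:=n) ((c, f) :: t) = fun v => c * form_pow f v + pow_sum t v.
  by apply/funext => v; rewrite /pow_sum big_cons.
exists (fun (m : 'I_n.+1) x (v : 'I_m -> H) => c * K m x v + L m x v).
by apply: transport_lin KP LP; [exact: HSform_pow|exact: HSform_pow_sum].
Qed.

(** Pairing with [sprod w] yields m! times the value at [w], both for [J x] and for the form
    integrated; the factor cancels. *)
Lemma vector_integral_onb n (A : mform H n) (m : 'I_n.+1) (J : X -> mform H m) w :
  HSform H n A -> onb_tuples w ->
  is_vector_multiple_integral mu (HSform H m) hs_dot (@Imu (n - m)%N)
    (curry_form (subnK (leq_ord m)) A) J ->
  \forall x \ae mu,
    J x w = Imu (fun h => curry_form (subnK (leq_ord m)) A h w) x.
Proof.
move=> HA Ew [JH _ _ /(_ _ (HSform_sprod w))]; have [_ As _ _] := HA.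
have -> : (fun h => hs_dot (curry_form (subnK (leq_ord m)) A h) (sprod w)) =
  (fun h => m`!%:R * curry_form (subnK (leq_ord m)) A h w).
  by apply/funext => h; rewrite hs_dot_sprod//; exact: curry_form_symmetric.
apply: ae_imp2 (multiple_integralZ (ImuP _) m`!%:R (HSform_curry HA Ew)) => x ->.
have [_ Js _ _] := JH x; rewrite hs_dot_sprod//.
by apply: mulfI; rewrite pnatr_eq0 -lt0n fact_gt0.
Qed.

(** This is the boundedness of the vector-valued integral. The constant is that of the scalar
    integral of order n - m, applied to each slice, and [hs_sqnorm_slices] adds up the slices. *)
Lemma slice_integral_sqr_le n (m : 'I_n.+1) : exists2 C, 0 <= C & forall D : mform H n,
  HSform H n D ->
  (\int[mu]_x (\esum_(w in onb_tuples (n:=m))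
      ((Imu (fun h => curry_form (subnK (leq_ord m)) D h w) x) ^+ 2)%:E) <=
    C%:E * hs_sqnorm D)%E.
Proof.
have [C C0 CP] := multiple_integral_sqr_le (ImuP (n - m)%N).
exists C => // D HD; rewrite integral_esum; first last.
- by move=> w x; exact: sqre_ge0.
- move=> w Ew; apply/measurable_EFinP/measurable_funX.
  exact: (measurable_multiple_integral (ImuP (n - m)%N) (HSform_curry HD Ew)).
- exact: onb_tuples_countable.
rewrite (hs_sqnorm_slices (subnK (leq_ord m)) D) -esumZl//; last first.
  by move=> w; exact: hs_sqnorm_ge0.
by apply: le_esum => w Ew; apply: CP; exact: HSform_curry.
Qed.

Lemma sqr_cvg0 (u : nat -> R) :
  (forall e, 0 < e -> exists N, forall j, (N <= j)%N -> u j ^+ 2 <= e) ->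
  u @ \oo --> 0.
Proof.
move=> ue; apply/cvgr0Pnorm_le => e e0.
have [N HN] := ue _ (exprn_gt0 2 e0).
exists N => // j /= /HN; rewrite -[u j ^+ 2]real_normK ?num_real//.
by rewrite ler_pXn2r// nnegrE ltW.
Qed.

Lemma cvg_lincomb0 (I : Type) (r : seq I) (c : I -> R) (v : I -> nat -> R) :
  (forall i, v i @ \oo --> (0 : R)) ->
  (fun j => \sum_(i <- r) c i * v i j) @ \oo --> (0 : R).
Proof.
move=> v0; elim: r => [|i r IH].
  have -> : (fun j => \sum_(i <- [::]) c i * v i j) = fun=> 0 :> R.
    by apply/funext => j; rewrite big_nil.
  exact: cvg_cst.
have -> : (fun j => \sum_(i <- i :: r) c i * v i j) =
    (fun j => c i * v i j + \sum_(i <- r) c i * v i j).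
  by apply/funext => j; rewrite big_cons.
rewrite -[X in _ --> X](addr0 0); apply: cvgD => //.
rewrite -[X in _ --> X](mulr0 (c i)).
by apply: cvgM; [exact: cvg_cst|exact: v0].
Qed.

Lemma transport_HSform n (A : mform H n) (J : forall m : 'I_n.+1, X -> mform H m) :
  HSform H n A ->
  (forall m : 'I_n.+1,
    is_vector_multiple_integral mu (HSform H m) hs_dot
      (@Imu (n - m)%N) (curry_form (subnK (leq_ord m)) A) (J m)) ->
  \forall x \ae nu, X0 x -> Imu A (T x) =
    \sum_(m < n.+1) 'C(n, m)%:R * J m x (diag (shift_vec x)).
Proof.
move=> HA HJ.
have /choice[t tP] : forall j : nat, exists t : seq (R * H),
    {in t, forall p, dual_vec iota p.2} /\
    (hs_sqnorm (fun v => (A v - pow_sum (n:=n) t v)%R) <= (1 / (2 ^ j.+1)%:R)%:E)%E.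
  move=> j; have j0 : 0 < 1 / (2 ^ j.+1)%:R :> R by rewrite divr_gt0// ltr0n expn_gt0.
  have dd h r := @dual_vec_dense _ _ _ _ h iota_inj iota_cont r.
  by have [t tD tA] := pow_sum_dense_in dd HA j0; exists t.
have /choice[K KP] : forall j, exists K, transport_formula (pow_sum (n:=n) (t j)) K.
  by move=> j; apply: transport_pow_sum; exact: (tP j).1.
pose D j : mform H n := fun v => A v - pow_sum (n:=n) (t j) v.
have HP j : HSform H n (pow_sum (n:=n) (t j)) by exact: HSform_pow_sum.
have HD j : HSform H n (D j) by exact: HSformB.
have hsD C j : 0 <= C -> (C%:E * hs_sqnorm (D j) <= (C / (2 ^ j.+1)%:R)%:E)%E.
  move=> C0; apply: le_trans (lee_wpmul2l _ (tP j).2) _; first by rewrite lee_fin.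
  by rewrite -EFinM mul1r.
have F1 : \forall x \ae mu, forall e : R, 0 < e -> exists N, forall j, (N <= j)%N ->
    ((Imu (D j) x ^+ 2)%:E <= e%:E)%E.
  have [C C0 CP] := multiple_integral_sqr_le (ImuP n).
  apply: (@ae_small _ _ _ mu (fun j (x : borel X) => (Imu (D j) x ^+ 2)%:E) C).
  - move=> j; apply/measurable_EFinP/measurable_funX.
    exact: (measurable_multiple_integral (ImuP n) (HD j)).
  - by move=> j x; exact: sqre_ge0.
  - by move=> j; apply: le_trans (CP _ (HD j)) (hsD _ _ C0).
pose G (m : 'I_n.+1) j x := (\esum_(w in onb_tuples (H:=H) (n:=m))
      ((Imu (fun h => curry_form (subnK (leq_ord m)) (D j) h w) x) ^+ 2)%:E)%E.
have F2 : \forall x \ae mu, forall m : 'I_n.+1, forall e : R, 0 < e ->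
    exists N, forall j, (N <= j)%N -> (G m j x <= e%:E)%E.
  apply: ae_ord => m; have [C C0 CP] := slice_integral_sqr_le m.
  apply: (@ae_small _ _ _ mu (fun j (x : borel X) => G m j x) C).
  - move=> j; apply: measurable_esum.
    + exact: onb_tuples_countable.
    + move=> w Ew; apply/measurable_EFinP/measurable_funX.
      exact: (measurable_multiple_integral (ImuP (n - m)%N) (HSform_curry (HD j) Ew)).
    + by move=> w x; exact: sqre_ge0.
  - by move=> j x; apply: esum_ge0 => w _; exact: sqre_ge0.
  - by move=> j; apply: le_trans (CP _ (HD j)) (hsD _ _ C0).
(* One null set serves all [m], [j] and basis tuples, which are countably many: on the basis, [J]
   minus [K j] is the vector-valued integral of [D j]. *)
have F3 : \forall x \ae mu, forall (m : 'I_n.+1) (j : nat) (w : 'I_m -> H), onb_tuples w ->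
    J m x w - K j m x w = Imu (fun h => curry_form (subnK (leq_ord m)) (D j) h w) x.
  apply: ae_ord => m; apply: ae_nat => j; apply: ae_countable.
    exact: onb_tuples_countable.
  move=> w Ew; have [_ /(_ m w Ew) KI _] := KP j.
  have hB := multiple_integralB (ImuP (n - m)%N) (HSform_curry HA Ew) (HSform_curry (HP j) Ew).
  apply: ae_imp2 hB (ae_and KI (vector_integral_onb HA Ew (HJ m))) => x hB [-> ->].
  by rewrite -hB.
have F4 : \forall x \ae mu, forall j, Imu (D j) x = Imu A x - Imu (pow_sum (n:=n) (t j)) x.
  apply: (@ae_nat _ _ mu (fun j x => Imu (D j) x = Imu A x - Imu (pow_sum (n:=n) (t j)) x)) => j.
  exact: (multiple_integralB (ImuP n) HA (HP j)).
have F5 : \forall x \ae nu, forall j, X0 x -> Imu (pow_sum (n:=n) (t j)) (T x) =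
    \sum_(m < n.+1) 'C(n, m)%:R * K j m x (diag (shift_vec x)).
  apply: (@ae_nat _ _ nu (fun j x => X0 x -> Imu (pow_sum (n:=n) (t j)) (T x) =
    \sum_(m < n.+1) 'C(n, m)%:R * K j m x (diag (shift_vec x)))) => j.
  by have [] := KP j.
have F14 := ae_pullback X0_borel T_meas nu_T (ae_and F1 F4).
have F23 := ae_dominated nu_mu (ae_and F2 F3).
apply: ae_imp2 (ae_and F14 F23) F5 => x [F14x [F2x F3x]] F5x X0x.
have {F14x}[F1x F4x] := F14x X0x.
set h := shift_vec x.
(* The defect of the formula at [x]. It does not involve [j], yet [LE] expresses it by errors
   tending to 0, because the formula is exact for the approximating sums of powers. *)
pose L := Imu A (T x) - \sum_(m < n.+1) 'C(n, m)%:R * J m x (diag h).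
have LE j : L = Imu (D j) (T x) -
    \sum_(m < n.+1) 'C(n, m)%:R * (J m x (diag h) - K j m x (diag h)).
  rewrite F4x (F5x j X0x) -/h /L -addrA; congr (_ + _).
  rewrite -opprD -big_split/=; congr (- _); apply: eq_bigr => m _; ring.
have u0 : (fun j => Imu (D j) (T x)) @ \oo --> (0 : R).
  apply: sqr_cvg0 => e e0; have [N HN] := F1x e e0; exists N => j Nj.
  by rewrite -lee_fin; exact: HN.
have v0 (m : 'I_n.+1) : (fun j => J m x (diag h) - K j m x (diag h)) @ \oo --> (0 : R).
  apply: sqr_cvg0 => e e0; pose c := ((`|h| + 1) ^+ m) ^+ 2.
  have c0 : 0 < c by rewrite !exprn_gt0// ltr_wpDl.
  have [N HN] := F2x m (e / c) (divr_gt0 e0 c0); exists N => j Nj.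
  have HJK : HSform H m (fun w => J m x w - K j m x w).
    by apply: HSformB; [have [JH _ _ _] := HJ m; exact: JH|have [KH _ _] := KP j; exact: KH].
  have [JKl _ JKb _] := HJK.
  rewrite -lee_fin; apply: le_trans (form_diag_sqr_le h JKl JKb) _.
  (* The norm sees basis tuples only, and there [F3x] identifies the values. *)
  have -> : hs_sqnorm (fun w => J m x w - K j m x w) = G m j x.
    by apply: eq_esum => w Ew; rewrite F3x.
  apply: le_trans (lee_wpmul2l _ (HN j Nj)) _; first exact: sqre_ge0.
  by rewrite -EFinM lee_fin mulrC divfK// gt_eqF.
have : (fun _ : nat => L) @ \oo --> (0 : R).
  rewrite (_ : (fun _ => L) = (fun j => Imu (D j) (T x) -
      \sum_(m < n.+1) 'C(n, m)%:R * (J m x (diag h) - K j m x (diag h)))); last first.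
    by apply/funext => j; exact: LE.
  rewrite -[X in _ --> X](subr0 0); apply: cvgB => //.
  exact: cvg_lincomb0.
move=> /(cvg_lim (@Rhausdorff R)); rewrite lim_cst// => /eqP.
by rewrite subr_eq0 => /eqP.
Qed.

End transport.

Theorem theorem3p3 (R : realType) (X : completeNormedModType R)
    (H : hilbertType R) (iota : {linear H -> X})
    (mu nu : probability (borel X) R)
    (sepX : separable X)
    (mu_gauss : centered_gaussian mu)
    (mu_supp : measure_support mu = setT)
    (mu_cm : cameron_martin iota mu)
    (Imu : forall n : nat, mform H n -> X -> R)
    (ImuP : forall n : nat, is_multiple_integral iota mu (Imu n))
    (X0 : set (borel X)) (T : borel X -> borel X)
    (X0_borel : measurable X0)
    (nu_X0 : nu X0 = 1%E)
    (T_meas : measurable_fun X0 T)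
    (T_inj : {in X0 &, injective T})
    (nu_T : forall B : set (borel X), measurable B ->
       nu (X0 `&` T @^-1` B) = mu B)
    (T_shift : forall x : X, X0 x -> range iota ((T x : X) - x))
    (nu_mu : nu `<< mu) :
  let Inu n (A : mform H n) : X -> R := Imu n A \o T in
  forall (n : nat) (A : mform H n), HSform H n A ->
  forall J : (forall m : 'I_n.+1, X -> mform H m),
    (forall m : 'I_n.+1,
       is_vector_multiple_integral mu (HSform H m) hs_dot
         (Imu (n - m)%N) (curry_form (subnK (leq_ord m)) A) (J m)) ->
  \forall x \ae nu, Inu n A x =
    \sum_(m < n.+1)
      'C(n, m)%:R * J m x (diag (cm_vec iota ((T x : X) - (x : X)))).
Proof.
move=> Inu n A HA J HJ; have [sepH iota_inj [iota_cont _] _ _] := mu_cm.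
have := transport_HSform iota_inj iota_cont sepH ImuP X0_borel T_meas nu_T
  T_shift nu_mu HA HJ.
by apply: ae_imp2 (ae_full X0_borel nu_X0) => x X0x /(_ X0x).
Qed.
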